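(* Let $k$ be an algebraically closed field and let $u$ be transcendental over $k$. Then every countably generated algebraic extension of $k(u)$ can be realized as the residue field $\Delta_v$ of some discrete rank one valuation $v$ of $k((X_1,X_2,X_3))/k$ whose ring contains $k[[X_1,X_2,X_3]]$ and whose center in $k[[X_1,X_2,X_3]]$ is the maximal ideal.
   Context: $k((X_1,X_2,X_3))$ denotes the quotient field of $k[[X_1,X_2,X_3]]$. A valuation of $K/k$ is a valuation of $K$ trivial on $k$; $\Delta_v$ is its residue field, regarded as an extension of $k$, and ''realized'' means that $\Delta_v$ is isomorphic, over $k$, to the given field. *)

(* Defs.v *)
From HB Require Import structures.
From mathcomp Require Import all_boot all_order all_algebra.
From mathcomp Require Import boolp classical_sets functions cardinality.
From mathcomp.multinomials Require Import mpoly.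

Set Implicit Arguments.
Unset Strict Implicit.
Unset Printing Implicit Defensive.

Import Order.TTheory GRing.Theory Num.Theory.

Local Open Scope ring_scope.

Record mfps (n : nat) (R : Type) := MFPS { mfcoef : 'X_{1..n} -> R }.

Notation "{ 'mfps' R [ n ] }" := (mfps n R)
  (at level 0, R at level 2, n at level 2, format "{ 'mfps'  R [ n ] }").

HB.instance Definition _ n R := gen_eqMixin {mfps R[n]}.
HB.instance Definition _ n R := gen_choiceMixin {mfps R[n]}.

Lemma mfpsP n R (f g : {mfps R[n]}) : mfcoef f =1 mfcoef g -> f = g.
Proof. by case: f g => [f] [g] /= /funext ->. Qed.

Section MfpsRing.
Variables (n : nat) (R : comNzRingType).
Implicit Types (f g h : {mfps R[n]}) (m : 'X_{1..n}) (p q : {mpoly R[n]}).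

Definition mfpsC (c : R) : {mfps R[n]} := MFPS (fun m => c *+ (m == 0%MM)).
Definition mfps_add f g : {mfps R[n]} :=
  MFPS (fun m => mfcoef f m + mfcoef g m).
Definition mfps_opp f : {mfps R[n]} := MFPS (fun m => - mfcoef f m).

(* The sum is over all pairs (a, b) with a + b = m: the degree bounds only
   make the index type finite. *)
Definition mfps_mul f g : {mfps R[n]} := MFPS (fun m =>
  \sum_(ab : 'X_{1..n < (mdeg m).+1, (mdeg m).+1} | m == (ab.1 + ab.2)%MM)
     mfcoef f ab.1 * mfcoef g ab.2).

Lemma mfps_addA : associative mfps_add.
Proof. by move=> f g h; apply: mfpsP => m; apply: addrA. Qed.
Lemma mfps_addC : commutative mfps_add.
Proof. by move=> f g; apply: mfpsP => m; apply: addrC. Qed.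
Lemma mfps_add0 : left_id (mfpsC 0) mfps_add.
Proof. by move=> f; apply: mfpsP => m /=; rewrite mul0rn add0r. Qed.
Lemma mfps_addN : left_inverse (mfpsC 0) mfps_opp mfps_add.
Proof. by move=> f; apply: mfpsP => m /=; rewrite mul0rn addNr. Qed.

HB.instance Definition _ := GRing.isZmodule.Build {mfps R[n]}
  mfps_addA mfps_addC mfps_add0 mfps_addN.

Definition mfps_trunc (d : nat) f : {mpoly R[n]} :=
  \sum_(m : 'X_{1..n < d}) mfcoef f m *: 'X_[m].

Definition mfps_approx d p f :=
  forall m, (mdeg m < d)%N -> p@_m = mfcoef f m.

Lemma mfps_truncP d f : mfps_approx d (mfps_trunc d f) f.
Proof.
move=> m md; rewrite /mfps_trunc raddf_sum /= (bigD1 (BMultinom md)) //=.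
rewrite mcoeffZ mcoeffX eqxx mulr1 big1 ?addr0 // => m' ne.
by rewrite mcoeffZ mcoeffX -[m in _ == m]/(bmnm (BMultinom md)) -bmeqP
  (negPf ne) mulr0.
Qed.

Arguments mfps_truncP : clear implicits.

Lemma mfps_mulP d p q f g : mfps_approx d p f -> mfps_approx d q g ->
  mfps_approx d (p * q) (mfps_mul f g).
Proof.
move=> hp hq m md; rewrite mcoeffM; apply: eq_bigr => -[a b] _ /=.
by rewrite hp ?hq //; apply: leq_trans md; rewrite ltnS -ltnS bmdeg.
Qed.

Lemma mfps_approxC d c : mfps_approx d c%:MP (mfpsC c).
Proof. by move=> m _; rewrite mcoeffC mulr_natr. Qed.

Lemma mfps_approxD d p q f g : mfps_approx d p f -> mfps_approx d q g ->
  mfps_approx d (p + q) (f + g).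
Proof. by move=> hp hq m md; rewrite mcoeffD hp ?hq. Qed.

Lemma mfps_approx_inj f g :
  (forall d, exists2 p, mfps_approx d p f & mfps_approx d p g) -> f = g.
Proof.
move=> h; apply: mfpsP => m; have [p hf hg] := h (mdeg m).+1.
by rewrite -hf // hg.
Qed.

Lemma mfps_mulA : associative mfps_mul.
Proof.
move=> f g h; apply: mfps_approx_inj => d.
have [[Tf Tg] Th] := (mfps_truncP d f, mfps_truncP d g, mfps_truncP d h).
exists (mfps_trunc d f * (mfps_trunc d g * mfps_trunc d h)).
  by apply: mfps_mulP => //; apply: mfps_mulP.
by rewrite mulrA; apply: mfps_mulP => //; apply: mfps_mulP.
Qed.

Lemma mfps_mulC : commutative mfps_mul.
Proof.
move=> f g; apply: mfps_approx_inj => d.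
have [Tf Tg] := (mfps_truncP d f, mfps_truncP d g).
exists (mfps_trunc d f * mfps_trunc d g); first exact: mfps_mulP.
by rewrite mulrC; apply: mfps_mulP.
Qed.

Lemma mfps_mul1 : left_id (mfpsC 1) mfps_mul.
Proof.
move=> f; apply: mfps_approx_inj => d; have Tf := mfps_truncP d f.
exists (1%:MP * mfps_trunc d f); last by rewrite mul1r.
by apply: mfps_mulP => //; apply: mfps_approxC.
Qed.

Lemma mfps_mulD : left_distributive mfps_mul +%R.
Proof.
move=> f g h; apply: mfps_approx_inj => d.
have [[Tf Tg] Th] := (mfps_truncP d f, mfps_truncP d g, mfps_truncP d h).
exists ((mfps_trunc d f + mfps_trunc d g) * mfps_trunc d h).
  by apply: mfps_mulP => //; apply: mfps_approxD.
by rewrite mulrDl; apply: mfps_approxD; apply: mfps_mulP.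
Qed.

Lemma mfps_neq0 : mfpsC 1 != 0.
Proof.
apply/eqP => /(congr1 (fun f => mfcoef f 0%MM)) /eqP /=.
by rewrite eqxx mul0rn oner_eq0.
Qed.

HB.instance Definition _ := GRing.Zmodule_isComNzRing.Build {mfps R[n]}
  mfps_mulA mfps_mulC mfps_mul1 mfps_mulD mfps_neq0.

Lemma mfcoef0 m : mfcoef (0 : {mfps R[n]}) m = 0.
Proof. by rewrite /= mul0rn. Qed.

Lemma mfcoefM f g m : mfcoef (f * g) m =
  \sum_(ab : 'X_{1..n < (mdeg m).+1, (mdeg m).+1} | m == (ab.1 + ab.2)%MM)
     mfcoef f ab.1 * mfcoef g ab.2.
Proof. by []. Qed.

Lemma mfpsC_is_zmod_morphism : zmod_morphism mfpsC.
Proof. by move=> a b; apply: mfpsP => m /=; rewrite mulrnBl. Qed.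

Lemma mfpsC_is_monoid_morphism : monoid_morphism mfpsC.
Proof.
split=> // a b; apply: mfps_approx_inj => d; exists (a * b)%:MP.
  exact: mfps_approxC.
by rewrite mpolyCM; apply: mfps_mulP; apply: mfps_approxC.
Qed.

HB.instance Definition _ := GRing.isZmodMorphism.Build R {mfps R[n]} mfpsC
  mfpsC_is_zmod_morphism.
HB.instance Definition _ := GRing.isMonoidMorphism.Build R {mfps R[n]} mfpsC
  mfpsC_is_monoid_morphism.

Definition mfps_unit : pred {mfps R[n]} := fun f => `[< exists g, g * f = 1 >].
Definition mfps_inv f : {mfps R[n]} := xget f [set g | g * f = 1]%classic.

Lemma mfps_mulV : {in mfps_unit, left_inverse 1 mfps_inv *%R}.
Proof.
by move=> f /asboolP[g gf]; rewrite /mfps_inv; case: xgetP => // /(_ g).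
Qed.

Lemma mfps_unitP f g : g * f = 1 -> mfps_unit f.
Proof. by move=> gf; apply/asboolP; exists g. Qed.

Lemma mfps_inv_out : {in [predC mfps_unit], mfps_inv =1 id}.
Proof.
move=> f /asboolP nf; rewrite /mfps_inv; case: xgetP => // g _ gf.
by case: nf; exists g.
Qed.

HB.instance Definition _ := GRing.ComNzRing_hasMulInverse.Build {mfps R[n]}
  mfps_mulV mfps_unitP mfps_inv_out.

End MfpsRing.

Section MfpsDomain.
Variables (n : nat) (R : idomainType).

Lemma mfps_least (f : {mfps R[n]}) : f != 0 ->
  exists2 m, mfcoef f m != 0 & forall m', mfcoef f m' != 0 -> (m <= m')%O.
Proof.
move=> f0; have [m fm] : exists m, mfcoef f m != 0.
  apply: contrapT => h; case/eqP: f0; apply: mfpsP => m; rewrite mfcoef0.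
  by apply/eqP; apply: contrapT => /negP fm; apply: h; exists m.
elim/(@ltmwf n): m fm => m ih fm.
have [[m' fm' lt]|h] := pselect (exists2 m', mfcoef f m' != 0 & (m' < m)%O).
  exact: ih lt fm'.
by exists m => // m' fm'; rewrite leNgt; apply/negP => lt; apply: h; exists m'.
Qed.

Lemma mfps_integral (f g : {mfps R[n]}) : f * g = 0 -> (f == 0) || (g == 0).
Proof.
move=> fg; apply: contrapT => /negP; rewrite negb_or => /andP[].
move=> /mfps_least[a fa lea] /mfps_least[b gb leb].
have /eqP := congr1 (fun h => mfcoef h (a + b)%MM) fg; apply/negP.
rewrite mfcoef0 mfcoefM.
have ha : (mdeg a < (mdeg (a + b)).+1)%N by rewrite mdegD ltnS leq_addr.
have hb : (mdeg b < (mdeg (a + b)).+1)%N by rewrite mdegD ltnS leq_addl.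
rewrite (bigD1 (BMultinom ha, BMultinom hb)) //= big1 ?addr0 ?mulf_neq0 //.
move=> [a' b'] /= /andP[/eqP e ne]; apply/eqP; apply: contraNT ne.
rewrite mulf_eq0 negb_or => /andP[/lea la /leb lb].
have ea : a = a' :> 'X_{1..n}.
  apply/eqP; move: la; rewrite le_eqVlt => /orP[//|lt].
  by have := ltmc_le_add lt lb; rewrite -e ltxx.
have eb : b = b' :> 'X_{1..n} by apply: (@addmI _ a); apply: etrans e _; rewrite -ea.
by rewrite xpair_eqE !bmeqP /= -ea -eb !eqxx.
Qed.

HB.instance Definition _ :=
  GRing.ComUnitRing_isIntegral.Build {mfps R[n]} mfps_integral.

End MfpsDomain.

(* The maximal ideal (X_1, ..., X_n); it is the set of all nonunits, see
   mfps_maxidealE. *)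
Definition mfps_maxideal (n : nat) (k : fieldType) : {pred {mfps k[n]}} :=
  fun f => mfcoef f 0%MM == 0.
Arguments mfps_maxideal {n k}.

Section MfpsLocal.
Variables (n : nat) (k : fieldType).
Implicit Types f g h : {mfps k[n]}.

Lemma mfcoefM_lt (d : nat) f g g' m :
  (forall m', (mdeg m' < d)%N -> mfcoef g m' = mfcoef g' m') ->
  (mdeg m < d)%N -> mfcoef (f * g) m = mfcoef (f * g') m.
Proof.
move=> gg md; rewrite !mfcoefM; apply: eq_bigr => -[a b] _ /=.
by rewrite gg //; apply: leq_trans md; rewrite ltnS -ltnS bmdeg.
Qed.

Lemma mfcoefM0 f g :
  mfcoef (f * g) 0%MM = mfcoef f 0%MM * mfcoef g 0%MM.
Proof.
have h0 : (mdeg (0%MM : 'X_{1..n}) < (mdeg (0%MM : 'X_{1..n})).+1)%N by [].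
rewrite mfcoefM (bigD1 (BMultinom h0, BMultinom h0)) /=; last first.
  by rewrite addm0.
rewrite big1 ?addr0 // => -[a b] /= /andP[/eqP e]; case/negP.
have : (mdeg a + mdeg b == 0)%N by rewrite -mdegD -e mdeg0.
by rewrite addn_eq0 !mdeg_eq0 xpair_eqE !bmeqP.
Qed.

Lemma mfcoefX_lt h i m : mfcoef h 0%MM = 0 -> (mdeg m < i)%N ->
  mfcoef (h ^+ i) m = 0.
Proof.
move=> h0; elim: i m => // i ih m mi; rewrite exprS mfcoefM big1 //.
move=> [a b] /= /eqP e; have := congr1 mdeg e; rewrite mdegD.
have [a0|a0] := eqVneq (bmnm a) 0%MM; first by rewrite a0 h0 mul0r.
move=> me; rewrite ih ?mulr0 //; have ab : (mdeg a + mdeg b <= i)%N by rewrite -me.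
by apply: leq_trans ab; rewrite -add1n leq_add2r lt0n mdeg_eq0.
Qed.

Lemma mfps_maxidealE f : (f \in mfps_maxideal) = (f \isn't a GRing.unit).
Proof.
rewrite unfold_in; have [f0|f0] := eqVneq (mfcoef f 0%MM) 0.
  apply/esym/negP => /divrr /(congr1 (fun g => mfcoef g 0%MM)) /eqP.
  by rewrite mfcoefM0 f0 mul0r /= eqxx eq_sym oner_eq0.
apply/esym/negbF; set c := mfcoef f 0%MM in f0.
pose h := 1 - mfpsC n c^-1 * f.
have h0 : mfcoef h 0%MM = 0.
  rewrite -[LHS]/(mfcoef 1 0%MM - mfcoef (mfpsC n c^-1 * f) 0%MM).
  by rewrite mfcoefM0 /= eqxx !mulr1n mulVf // subrr.
pose g : {mfps k[n]} :=
  MFPS (fun m => mfcoef (\sum_(i < (mdeg m).+1) h ^+ i) m).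
have mfcoef_sum (d : nat) m : mfcoef (\sum_(i < d) h ^+ i) m =
    \sum_(i < d) mfcoef (h ^+ i) m.
  by elim: d => [|d ih]; rewrite ?big_ord0 ?mfcoef0 // !big_ord_recr /= ih.
have gE (d : nat) m : (mdeg m < d)%N ->
    mfcoef g m = mfcoef (\sum_(i < d) h ^+ i) m.
  move=> md; rewrite [LHS]/= !mfcoef_sum.
  rewrite -!(big_mkord xpredT (fun i => mfcoef (h ^+ i) m)).
  rewrite (big_cat_nat (leq0n _) md) /= [X in _ = _ + X]big1_seq ?addr0 //.
  by move=> i; rewrite mem_index_iota => /andP[_ /andP[mi _]]; apply: mfcoefX_lt.
have hg : (1 - h) * g = 1.
  apply: mfpsP => m; rewrite (mfcoefM_lt _ (gE (mdeg m).+1)) //.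
  rewrite -opprB mulNr -subrX1 opprB.
  rewrite -[LHS]/(mfcoef 1 m - mfcoef (h ^+ (mdeg m).+1) m).
  by rewrite mfcoefX_lt // subr0.
apply/asboolP; exists (g * mfpsC n c^-1).
by rewrite -mulrA mulrC -[_ * f](subKr 1) -/h hg.
Qed.

End MfpsLocal.

(* Normalized discrete rank one valuations of K that are trivial on k: the
   value group is identified with the integers, and v is only meaningful at
   nonzero arguments (the value at 0 being infinite by convention). *)
Record discreteValuation (k K : fieldType) (j : {rmorphism k -> K}) :=
  DiscreteValuation {
    dval :> K -> int;
    dvalM : forall x y, x != 0 -> y != 0 -> dval (x * y) = dval x + dval y;
    dvalD : forall x y, x != 0 -> y != 0 -> x + y != 0 ->
      Num.min (dval x) (dval y) <= dval (x + y);
    dval_surj : forall z : int, exists2 x, x != 0 & dval x = z;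
    dval_triv : forall c, c != 0 -> dval (j c) = 0
  }.

Section Residue.
Variables (k K : fieldType) (j : {rmorphism k -> K}).
Variable v : discreteValuation j.

Definition vring_pred : {pred K} := fun x => (x == 0) || (0 <= v x).
Definition vmax_pred : {pred K} := fun x => (x == 0) || (0 < v x).

Lemma dval1 : v 1 = 0.
Proof. by rewrite -(rmorph1 j) dval_triv ?oner_eq0. Qed.

Lemma dvalV x : x != 0 -> v x^-1 = - v x.
Proof.
move=> x0; apply/eqP; rewrite -addr_eq0 -dvalM ?invr_eq0 //.
by rewrite mulVf // dval1.
Qed.

Lemma dvalN x : v (- x) = v x.
Proof.
have [->|x0] := eqVneq x 0; first by rewrite oppr0.
have N10 : (-1 : k) != 0 by rewrite oppr_eq0 oner_eq0.
rewrite -mulN1r -(rmorphN1 j) dvalM ?fmorph_eq0 //.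
by rewrite dval_triv ?add0r.
Qed.

Lemma vring_subring : subring_closed vring_pred.
Proof.
split=> [|x y|x y]; rewrite !unfold_in ?dval1 ?orbT //.
- have [->|x0] := eqVneq x 0; first by rewrite sub0r oppr_eq0 dvalN.
  have [->|y0] := eqVneq y 0; first by rewrite subr0 (negPf x0).
  have [//|xy0] := eqVneq (x - y) 0.
  have yN0 : - y != 0 by rewrite oppr_eq0.
  move=> /= vx vy; have := dvalD v x0 yN0 xy0; apply: le_trans.
  by rewrite le_min dvalN vx.
- have [->|x0] := eqVneq x 0; first by rewrite mul0r eqxx.
  have [->|y0] := eqVneq y 0; first by rewrite mulr0 eqxx.
  by move=> /= vx vy; rewrite dvalM ?addr_ge0 ?orbT.
Qed.

HB.instance Definition _ :=
  GRing.isSubringClosed.Build K vring_pred vring_subring.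

Record vring := VRing { vring_val : K; _ : vring_val \in vring_pred }.

HB.instance Definition _ := [isSub for vring_val].
HB.instance Definition _ := [Choice of vring by <:].
HB.instance Definition _ := [SubChoice_isSubComNzRing of vring by <:].

Definition vmax : {pred vring} := fun x => val x \in vmax_pred.

Lemma vmaxE x : (x \in vmax) = (val x == 0) || (0 < v (val x)).
Proof. by []. Qed.

Lemma vmax_idealr : idealr_closed vmax.
Proof.
split=> [||a x y]; rewrite ?(vmaxE 0, vmaxE 1) ?rmorph0 ?rmorph1 ?eqxx //.
  by rewrite oner_eq0 dval1 ltxx.
rewrite (vmaxE x) (vmaxE y) (vmaxE (a * x + y)) rmorphD rmorphM.
have := valP a; rewrite unfold_in /=.
move: (vring_val a) (vring_val x) (vring_val y) => {}a {}x {}y ha hx hy.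
have hax : (a * x == 0) || (0 < v (a * x)).
  move: ha hx; have [->|a0] := eqVneq a 0; first by rewrite mul0r eqxx.
  have [->|x0 /= va vx] := eqVneq x 0; first by rewrite mulr0 eqxx.
  by rewrite dvalM // ltr_wpDl ?orbT.
move: hax hy; have [->|ax0] := eqVneq (a * x) 0; first by rewrite add0r.
have [->|y0 /= vax vy] := eqVneq y 0; first by rewrite addr0 (negPf ax0).
have [//|s0] := eqVneq (a * x + y) 0.
by have := dvalD v ax0 y0 s0; apply: lt_le_trans; rewrite lt_min vax.
Qed.

HB.instance Definition _ := isIdealr.Build vring vmax vmax_idealr.

Definition residueField := {ideal_quot vmax}.
HB.instance Definition _ := GRing.ComNzRing.on residueField.

Definition residue (x : vring) : residueField := (\pi_{ideal_quot vmax} x)%qT.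

Definition residue_inv (a : residueField) : residueField :=
  if a == 0 then 0 else residue (insubd 0 (val (repr a))^-1).

Lemma residue_is_zmod_morphism : zmod_morphism residue.
Proof. exact: rmorphB. Qed.
Lemma residue_is_monoid_morphism : monoid_morphism residue.
Proof. by split; [apply: rmorph1|apply: rmorphM]. Qed.
HB.instance Definition _ := GRing.isZmodMorphism.Build vring residueField
  residue residue_is_zmod_morphism.
HB.instance Definition _ := GRing.isMonoidMorphism.Build vring residueField
  residue residue_is_monoid_morphism.

Lemma residue_eq0 x : (residue x == 0) = (val x \in vmax_pred).
Proof.
rewrite -(rmorph0 residue) /residue -Quotient.idealrBE subr0; reflexivity.
Qed.

Lemma residue_mulVf a : a != 0 -> residue_inv a * a = 1.
Proof.
move=> a0; rewrite /residue_inv (negPf a0).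
set x := repr a; have ax : a = residue x by rewrite /residue reprK.
move: a0; rewrite ax residue_eq0 unfold_in negb_or => /andP[x0].
rewrite -leNgt => vx; have vx0 : v (val x) = 0.
  apply/le_anti; rewrite vx /=.
  by have := valP x; rewrite unfold_in (negPf x0).
have xV : (val x)^-1 \in vring_pred.
  by rewrite unfold_in (dvalV x0) vx0 oppr0 lexx orbT.
rewrite -rmorphM -(rmorph1 residue); congr residue; apply: val_inj.
by rewrite rmorphM /= insubdK // mulVf.
Qed.

Lemma residue_inv0 : residue_inv 0 = 0.
Proof. by rewrite /residue_inv eqxx. Qed.

HB.instance Definition _ := GRing.ComNzRing_isField.Build residueField
  residue_mulVf residue_inv0.

Lemma vring_const c : j c \in vring_pred.
Proof.
rewrite unfold_in fmorph_eq0.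
by have [//|c0] := eqVneq c 0; rewrite dval_triv.
Qed.

Definition residueC (c : k) : residueField := residue (VRing (vring_const c)).

Lemma residueC_is_zmod_morphism : zmod_morphism residueC.
Proof.
move=> a b; rewrite /residueC -rmorphB; congr residue.
by apply: val_inj; rewrite [RHS]rmorphB /= rmorphB.
Qed.
Lemma residueC_is_monoid_morphism : monoid_morphism residueC.
Proof.
split=> [|a b].
  rewrite -(rmorph1 residue); congr residue.
  by apply: val_inj; rewrite [RHS]rmorph1 /= rmorph1.
rewrite /residueC -rmorphM; congr residue.
by apply: val_inj; rewrite [RHS]rmorphM /= rmorphM.
Qed.
HB.instance Definition _ := GRing.isZmodMorphism.Build k residueField
  residueC residueC_is_zmod_morphism.
HB.instance Definition _ := GRing.isMonoidMorphism.Build k residueField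
  residueC residueC_is_monoid_morphism.

End Residue.

Definition mfracC (n : nat) (k : fieldType) :
  {rmorphism k -> {fraction {mfps k[n]}}} :=
  GRing.RMorphism.clone _ _ (@tofrac _ \o @mfpsC n k) _.

(* Meaningful when the valuation ring contains R. *)
Definition center (k : fieldType) (R : idomainType)
    (j : {rmorphism k -> {fraction R}}) (v : discreteValuation j) : {pred R} :=
  fun f => tofrac f \in vmax_pred v.

(* A divring_closed subset of a field (containing 1, closed under subtraction
   and division) is a subfield. *)
Definition subfieldGen (L : fieldType) (A : set L) : set L :=
  smallest [set S : set L | divring_closed (mem S)]%classic A.

Definition countablyGenerated (F L : fieldType) (f : {rmorphism F -> L}) :=
  exists2 A : set L, countable A &
    (subfieldGen (range f `|` A) = setT)%classic.

Definition algebraicExt (F L : fieldType) (f : {rmorphism F -> L}) :=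
  forall x : L, algebraicOver f x.

(* Main.v *)
(* Substituting X_1 = t, X_2 = u t, X_3 = x := \sum_n a_n t^(n+1) defines a local
   homomorphism Phi from k[[X_1,X_2,X_3]] to L[[t]]; if it is injective, the t-adic
   order restricts to a valuation of the quotient field whose residue field lies
   in L, and the a_n have to be chosen so that Phi is injective and the residues
   fill L.

   Injectivity. The series F(T, uT, Y) factors as (Y - x(T))^j H with H(t, x) of
   finite order e. If F(t, ut, x) = 0, then at the partial sums x_n of x the
   coefficient of t^(j(n+1)+e) in F(t, ut, x_n) is (- a_n)^j c, with c independent of
   n large. These coefficients lie in finite-dimensional k-spaces determined by the
   earlier a_i, which is excluded by taking a_n = beta_n u^(M_n) with M_n growing
   fast enough.

   Residues. Let D be the t-adic closure in L[[t]] of the image of the quotient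
   field. Newton's method shows that a residue of D which is separable over k(u) is
   a constant in D; subtracting the corresponding term of x, or of a Frobenius power
   of x, exposes the next coefficient. So all generators b_n of L occur, provided
   that b_n = beta_n^(r_0 ... r_(n-1)) with r_i powers of the characteristic exponent
   such that b_i^(r_i) is separable over k(u). If L is perfect such beta_n exist.
   If not, some w = u^(1/p^m) in L is not a p-th power; then L is separable over
   k(w), and w replaces u. *)
Require Import Defs.
From HB Require Import structures.
From mathcomp Require Import all_boot all_order all_algebra.
From mathcomp Require Import boolp classical_sets functions cardinality.
From mathcomp Require Import ring.
From mathcomp.multinomials Require Import mpoly.

Set Implicit Arguments.
Unset Strict Implicit.
Unset Printing Implicit Defensive.

Import Order.TTheory GRing.Theory Num.Theory.

Local Open Scope ring_scope.

(** * Power series and substitution *)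

Section Order.
Variables (n : nat) (K : fieldType).
Implicit Types (f g h : {mfps K[n]}) (m : 'X_{1..n}).

(* [vanish d f]: f lies in the d-th power of the maximal ideal. *)
Definition vanish (d : nat) f := forall m, (mdeg m < d)%N -> mfcoef f m = 0.

Lemma mfcoefD f g m : mfcoef (f + g) m = mfcoef f m + mfcoef g m.
Proof. by []. Qed.

Lemma mfcoefN f m : mfcoef (- f) m = - mfcoef f m.
Proof. by []. Qed.

Lemma mfcoefB f g m : mfcoef (f - g) m = mfcoef f m - mfcoef g m.
Proof. by []. Qed.

Lemma mfcoefC (c : K) m : mfcoef (mfpsC n c) m = c *+ (m == 0%MM).
Proof. by []. Qed.

Lemma mfcoef_sum (I : Type) (r : seq I) (P : pred I) (F : I -> {mfps K[n]}) m :
  mfcoef (\sum_(i <- r | P i) F i) m = \sum_(i <- r | P i) mfcoef (F i) m.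
Proof.
by elim/big_rec2: _ => [|i a b _ <-]; rewrite ?mfcoef0 // mfcoefD.
Qed.

Lemma mfcoefCM (c : K) f m : mfcoef (mfpsC n c * f) m = c * mfcoef f m.
Proof.
rewrite mfcoefM.
have h0 : (mdeg (0%MM : 'X_{1..n}) < (mdeg m).+1)%N by rewrite mdeg0.
have hm : (mdeg m < (mdeg m).+1)%N by [].
rewrite (bigD1 (BMultinom h0, BMultinom hm)) /=; last by rewrite add0m.
rewrite eqxx mulr1n big1 ?addr0 // => -[a b] /= /andP[/eqP e ne].
have [a0|a0] := eqVneq (bmnm a) 0%MM; last by rewrite mulr0n mul0r.
have bm : bmnm b = m by apply/esym/(etrans e); rewrite a0 add0m.
by case/negP: ne; rewrite xpair_eqE !bmeqP /= a0 bm !eqxx.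
Qed.

Lemma vanishD d f g : vanish d f -> vanish d g -> vanish d (f + g).
Proof. by move=> hf hg m md; rewrite mfcoefD hf ?hg ?addr0. Qed.

Lemma vanishN d f : vanish d f -> vanish d (- f).
Proof. by move=> hf m md; rewrite mfcoefN hf ?oppr0. Qed.

Lemma vanishB d f g : vanish d f -> vanish d g -> vanish d (f - g).
Proof. by move=> hf hg; apply: vanishD hf (vanishN hg). Qed.

Lemma vanish0 d : vanish d 0.
Proof. by move=> m _; rewrite mfcoef0. Qed.

Lemma vanish_sum (I : Type) (r : seq I) (P : pred I) (F : I -> {mfps K[n]}) d :
  (forall i, P i -> vanish d (F i)) -> vanish d (\sum_(i <- r | P i) F i).
Proof.
move=> h; elim/big_ind: _ => //; [exact: vanish0|exact: vanishD].
Qed.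

Lemma vanishM a b f g : vanish a f -> vanish b g -> vanish (a + b) (f * g).
Proof.
move=> hf hg m; rewrite mfcoefM => md; apply: big1 => -[x y] /= /eqP/(congr1 mdeg).
rewrite mdegD => e.
have [xa|ax] := ltnP (mdeg x) a; first by rewrite hf ?mul0r.
rewrite hg ?mulr0 // -(ltn_add2l a); apply: leq_ltn_trans md.
by rewrite [in leqRHS]e leq_add2r.
Qed.

Lemma vanishW a b f : (b <= a)%N -> vanish a f -> vanish b f.
Proof. by move=> ba hf m mb; apply: hf; apply: leq_trans mb ba. Qed.

Lemma vanish_deg0 f : vanish 0 f.
Proof. by []. Qed.

Lemma vanishMl d f g : vanish d g -> vanish d (f * g).
Proof. exact: (@vanishM 0 d). Qed.

Lemma vanishMr d f g : vanish d f -> vanish d (f * g).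
Proof. by rewrite mulrC; apply: vanishMl. Qed.

Lemma vanish1P f : vanish 1 f <-> mfcoef f 0%MM = 0.
Proof.
split=> [|f0 m]; first by apply; rewrite mdeg0.
by rewrite ltnS leqn0 mdeg_eq0 => /eqP ->.
Qed.

Lemma vanishX d f : vanish 1 f -> vanish d (f ^+ d).
Proof.
move=> hf; elim: d => [|d ih]; first exact: vanish_deg0.
by rewrite exprS -add1n; apply: vanishM.
Qed.

Lemma vanish_all f : (forall d, vanish d f) -> f = 0.
Proof. by move=> h; apply: mfpsP => m; rewrite mfcoef0 (h (mdeg m).+1). Qed.

Lemma vanish_congM d f f' g g' :
  vanish d (f - f') -> vanish d (g - g') -> vanish d (f * g - f' * g').
Proof.
move=> hf hg.
rewrite (_ : _ - _ = f * (g - g') + (f - f') * g').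
  by apply: vanishD; [apply: vanishMl|apply: vanishMr].
by rewrite mulrBr mulrBl addrA subrK.
Qed.

Lemma mfps_coef0_sub f : mfcoef (f - mfpsC n (mfcoef f 0%MM)) 0%MM = 0.
Proof. by rewrite mfcoefB mfcoefC eqxx mulr1n subrr. Qed.

Lemma mfps_unitE f : (f \is a GRing.unit) = (mfcoef f 0%MM != 0).
Proof. by rewrite -[LHS]negbK -mfps_maxidealE. Qed.

Definition mfX (i : 'I_n) : {mfps K[n]} := MFPS (fun m => (m == U_(i)%MM)%:R).

Lemma mfX_neq0 i : mfX i != 0.
Proof.
apply/eqP => /(congr1 (fun f => mfcoef f U_(i)%MM)).
by rewrite mfcoef0 /= eqxx => /eqP; rewrite oner_eq0.
Qed.

Lemma vanish_mfX i : vanish 1 (mfX i).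
Proof. by apply/vanish1P; rewrite /= eq_sym mnm1_eq0. Qed.

Lemma mfcoef_mfXM i f m : mfcoef (mfX i * f) (U_(i) + m)%MM = mfcoef f m.
Proof.
rewrite mfcoefM; set D := mdeg _.
have h1 : (mdeg (U_(i)%MM : 'X_{1..n}) < D.+1)%N by rewrite ltnS /D mdegD leq_addr.
have hm : (mdeg m < D.+1)%N by rewrite ltnS /D mdegD leq_addl.
rewrite (bigD1 (BMultinom h1, BMultinom hm)) /=; last by rewrite eqxx.
rewrite eqxx mul1r big1 ?addr0 // => -[a b] /= /andP[/eqP e ne].
have [a0|a0] := eqVneq (bmnm a) U_(i)%MM; last by rewrite mul0r.
case/negP: ne; rewrite xpair_eqE !bmeqP /= a0 eqxx /=; apply/eqP/esym.
by move: e; rewrite a0 => /addmI.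
Qed.

Lemma mfcoef_mfXM0 i f m : m i = 0%N -> mfcoef (mfX i * f) m = 0.
Proof.
move=> mi; rewrite mfcoefM big1 // => -[a b] /= /eqP.
move=> /(congr1 (fun c : 'X_{1..n} => c i)); rewrite mi mnmDE => e.
have [a0|a0] := eqVneq (bmnm a) U_(i)%MM; last by rewrite mul0r.
by move: e; rewrite a0 mnm1E eqxx.
Qed.

Lemma mfcoef_mfXnM i d f m :
  mfcoef (mfX i ^+ d * f) (U_(i) *+ d + m)%MM = mfcoef f m.
Proof.
elim: d => [|d ih]; first by rewrite expr0 mul1r mulm0n add0m.
by rewrite exprS mulmS -mulrA -addmA mfcoef_mfXM.
Qed.

Lemma mfps_divXn i d f : (forall m, (m i < d)%N -> mfcoef f m = 0) ->
  exists g, f = mfX i ^+ d * g.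
Proof.
move=> hf; exists (MFPS (fun m => mfcoef f (U_(i) *+ d + m)%MM)).
apply: mfpsP => m; have [mi|mi] := ltnP (m i) d; last first.
  have -> : m = (U_(i) *+ d + (m - U_(i) *+ d))%MM.
    rewrite addmC submK //; apply/mnm_lepP => j; rewrite mulmnE mnm1E.
    by case: eqP => [<-|]; rewrite ?mul1n ?mul0n.
  by rewrite mfcoef_mfXnM.
rewrite hf //; move: mi; move: (MFPS _) => g; elim: d m {hf} => // d ih m mi.
rewrite exprS -mulrA; have [m0|m0] := eqVneq (m i) 0%N.
  by rewrite mfcoef_mfXM0.
have -> : m = (U_(i) + (m - U_(i)))%MM by rewrite addmC submK // lep1mP.
by rewrite mfcoef_mfXM -ih // mnmBE mnm1E eqxx subn1 -ltnS prednK // lt0n.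
Qed.

Lemma mmap1_mfX (a : 'X_{1..n}) :
  mmap1 (@mfX) a = MFPS (fun m => (m == a)%:R).
Proof.
move: {2}(mdeg a) (erefl (mdeg a)) => d; elim: d a => [|d ih] a.
  by move/eqP; rewrite mdeg_eq0 => /eqP ->; rewrite mmap11.
move=> ad; have [i ai] : exists i, a i != 0%N.
  apply: contrapT => a0; suff: a = 0%MM by move=> e; rewrite e mdeg0 in ad.
  apply/mnmP => i; rewrite mnm0E; apply: contrapT => /eqP ai.
  by apply: a0; exists i.
have ea : a = (U_(i) + (a - U_(i)))%MM by rewrite addmC submK // lep1mP.
rewrite ea commr_mmap1_M; last by move=> ? ?; apply: mulrC.
rewrite mmap1U ih; last first.
  by apply/eqP; rewrite -eqSS -ad [in X in _ == X]ea mdegD mdeg1.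
apply: mfpsP => b; have [b0|b0] := eqVneq (b i) 0%N; last first.
  have -> : b = (U_(i) + (b - U_(i)))%MM by rewrite addmC submK // lep1mP.
  by rewrite mfcoef_mfXM /= eqm_add2l.
rewrite mfcoef_mfXM0 //=; case: eqP => // /(congr1 (fun c : 'X_{1..n} => c i)).
by rewrite b0 mnmDE mnm1E eqxx.
Qed.

Lemma mmap_mfX (p : {mpoly K[n]}) m : mfcoef (mmap (@mfpsC n K) mfX p) m = p@_m.
Proof.
rewrite /mmap mfcoef_sum [in RHS](mpolyE p) raddf_sum; apply: eq_bigr => a _.
by rewrite mmap1_mfX mfcoefCM /= mcoeffZ mcoeffX eq_sym.
Qed.

End Order.
Arguments mfX {n K}.

(** * Substitution homomorphisms between power series rings *)

Section Subst.
Variables (k L : fieldType) (g : {rmorphism k -> L}) (n m : nat).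
Variable x : 'I_n -> {mfps L[m]}.
Hypothesis x0 : forall i, vanish 1 (x i).

Definition subst_coef : {rmorphism k -> {mfps L[m]}} :=
  GRing.RMorphism.clone _ _ (@mfpsC m L \o g) _.
Local Notation gC := subst_coef.
Local Notation ev := (mmap gC x).

Lemma vanish_mmap1 (a : 'X_{1..n}) : vanish (mdeg a) (mmap1 x a).
Proof.
rewrite /mmap1 mdegE; elim/big_rec2: _ => [|i d f _ ih]; first exact: vanish_deg0.
by apply: vanishM ih; apply: vanishX.
Qed.

Lemma vanish_mmap d p : (forall a, (mdeg a < d)%N -> p@_a = 0) -> vanish d (ev p).
Proof.
move=> hp; apply: vanish_sum => a _; have [ad|da] := ltnP (mdeg a) d.
  by rewrite hp // raddf0 mul0r; apply: vanish0.
by apply: vanishMl; apply: vanishW da _; apply: vanish_mmap1.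
Qed.

(** Since each x_i lies in the maximal ideal, monomials of degree above that of [a] do not
    contribute to the coefficient at [a], and a truncation of f suffices. *)
Definition subst (f : {mfps k[n]}) : {mfps L[m]} :=
  MFPS (fun a => mfcoef (ev (mfps_trunc (mdeg a).+1 f)) a).

Lemma mfps_truncE d (f : {mfps k[n]}) a : (mdeg a < d)%N ->
  (mfps_trunc d f)@_a = mfcoef f a.
Proof. exact: mfps_truncP. Qed.

Lemma substP d p (f : {mfps k[n]}) a : mfps_approx d p f -> (mdeg a < d)%N ->
  mfcoef (subst f) a = mfcoef (ev p) a.
Proof.
move=> pf ad; rewrite [LHS]/=; apply/eqP; rewrite -subr_eq0 -mfcoefB -rmorphB.
rewrite [X in X == 0](vanish_mmap (d := (mdeg a).+1)) // => b bd.
rewrite mcoeffB mfps_truncE // pf ?subrr //; exact: leq_trans bd ad.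
Qed.

Lemma subst_trunc d (f : {mfps k[n]}) : vanish d (subst f - ev (mfps_trunc d f)).
Proof.
move=> a ad; rewrite mfcoefB (@substP d (mfps_trunc d f)) ?subrr //.
exact: mfps_truncP.
Qed.

Lemma subst_is_zmod_morphism : zmod_morphism subst.
Proof.
move=> f h; apply: mfpsP => a; rewrite mfcoefB.
have [Tf Th] := (@mfps_truncP n k (mdeg a).+1 f, @mfps_truncP n k (mdeg a).+1 h).
rewrite (substP Tf) // (substP Th) //.
rewrite -mfcoefB -rmorphB; apply: (@substP (mdeg a).+1) => // b bd.
by rewrite mcoeffB mfcoefB Tf ?Th.
Qed.

Lemma subst_is_monoid_morphism : monoid_morphism subst.
Proof.
split=> [|f h]; apply: mfpsP => a.
  rewrite (@substP (mdeg a).+1 1) ?rmorph1 //.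
  by rewrite -mpolyC1; apply: mfps_approxC.
have [Tf Th] := (@mfps_truncP n k (mdeg a).+1 f, @mfps_truncP n k (mdeg a).+1 h).
rewrite (substP (mfps_mulP Tf Th)) // rmorphM.
apply/esym/eqP; rewrite -subr_eq0 -mfcoefB; apply/eqP.
by apply: (vanish_congM (@subst_trunc (mdeg a).+1 f) (@subst_trunc (mdeg a).+1 h)).
Qed.

Definition substm : {rmorphism {mfps k[n]} -> {mfps L[m]}} :=
  HB.pack_for {rmorphism {mfps k[n]} -> {mfps L[m]}} subst
    (GRing.isZmodMorphism.Build {mfps k[n]} {mfps L[m]} subst
      subst_is_zmod_morphism)
    (GRing.isMonoidMorphism.Build {mfps k[n]} {mfps L[m]} subst
      subst_is_monoid_morphism).

Lemma substC c : substm (mfpsC n c) = mfpsC m (g c).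
Proof.
apply: mfpsP => a; rewrite (@substP (mdeg a).+1 c%:MP) ?mmapC //.
exact: mfps_approxC.
Qed.

Lemma substX i : substm (mfX i) = x i.
Proof.
apply: mfpsP => a; rewrite (@substP (mdeg a).+1 'X_i) ?mmapX ?mmap1U //.
by move=> b _; rewrite mcoeffX eq_sym.
Qed.

Lemma subst_vanish d f : vanish d f -> vanish d (substm f).
Proof.
move=> hf a ad; rewrite (@substP d 0) ?rmorph0 ?mfcoef0 // => b bd.
by rewrite mcoeff0 hf.
Qed.

Lemma subst_coef0 f : mfcoef (substm f) 0%MM = g (mfcoef f 0%MM).
Proof.
rewrite (@substP 1 (mfcoef f 0%MM)%:MP) ?mdeg0 // ?mmapC /= ?eqxx //.
move=> b; rewrite ltnS leqn0 mdeg_eq0 => /eqP ->.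
by rewrite mcoeffC eqxx mulr1.
Qed.

(** Polynomials are dense, so a homomorphism compatible with the adic filtration is determined by
    its values on constants and variables. This serves to identify composites of substitutions. *)
Lemma subst_uniq (phi : {rmorphism {mfps k[n]} -> {mfps L[m]}}) :
    (forall d f, vanish d f -> vanish d (phi f)) ->
    (forall c, phi (mfpsC n c) = mfpsC m (g c)) ->
    (forall i, phi (mfX i) = x i) ->
  phi =1 substm.
Proof.
move=> hv hC hX f; apply/eqP; rewrite -subr_eq0; apply/eqP.
apply: vanish_all => d; set p := mfps_trunc d f.
have phip (q : {mpoly k[n]}) : phi (mmap (@mfpsC n k) mfX q) = ev q.
  rewrite /mmap rmorph_sum; apply: eq_bigr => a _.
  rewrite rmorphM hC /=; congr (_ * _); rewrite /mmap1 rmorph_prod.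
  by apply: eq_bigr => i _; rewrite rmorphXn hX.
set q := mmap (@mfpsC n k) mfX p in phip *.
have hd : vanish d (f - q).
  by move=> a ad; rewrite mfcoefB mmap_mfX mfps_truncE // subrr.
rewrite -[f in phi f](subrK q) rmorphD phip -addrA; apply: vanishD; first exact: hv.
by rewrite -opprB; apply: vanishN; apply: subst_trunc.
Qed.

End Subst.

Section SubstTheory.
Variables (k L : fieldType) (g : {rmorphism k -> L}) (n m : nat).

Lemma subst_coefE (x : 'I_n -> {mfps L[m]}) (x0 : forall i, vanish 1 (x i))
    d (f : {mfps k[n]}) a : (mdeg a < d)%N ->
  mfcoef (substm g x0 f) a =
    \sum_(b : 'X_{1..n < d}) g (mfcoef f b) * mfcoef (mmap1 x b) a.
Proof.
move=> ad; rewrite [mfcoef _ _](substP g x0 (@mfps_truncP n k d f)) //.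
rewrite /mfps_trunc raddf_sum mfcoef_sum; apply: eq_bigr => b _ /=.
by rewrite mmapZ mmapX; apply: mfcoefCM.
Qed.

(** Congruences modulo a power of the maximal ideal are multiplicative, so substitution depends
    continuously on the series substituted. *)
Lemma substm_cong (x y : 'I_n -> {mfps L[m]}) (x0 : forall i, vanish 1 (x i))
    (y0 : forall i, vanish 1 (y i)) d f : (forall i, vanish d (x i - y i)) ->
  vanish d (substm g x0 f - substm g y0 f).
Proof.
move=> xy a ad; rewrite mfcoefB !(@subst_coefE _ _ d) // -sumrB big1 // => b _.
rewrite -mulrBr -mfcoefB [X in _ * X](_ : _ = 0) ?mulr0 //.
suff: vanish d (mmap1 x b - mmap1 y b) by apply.
rewrite /mmap1.
elim/big_ind2: _ => [|???? ? ?|i _]; first by rewrite subrr; apply: vanish0.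
  exact: vanish_congM.
elim: (b i) => [|e ih]; first by rewrite !expr0 subrr; apply: vanish0.
by rewrite !exprS; apply: vanish_congM.
Qed.

End SubstTheory.

Lemma substm_comp (k L M : fieldType) (g1 : {rmorphism k -> L})
    (g2 : {rmorphism L -> M}) (g3 : {rmorphism k -> M}) n m l
    (x : 'I_n -> {mfps L[m]}) (y : 'I_m -> {mfps M[l]}) (z : 'I_n -> {mfps M[l]})
    (x0 : forall i, vanish 1 (x i)) (y0 : forall i, vanish 1 (y i))
    (z0 : forall i, vanish 1 (z i)) f :
    (forall c, g2 (g1 c) = g3 c) -> (forall i, substm g2 y0 (x i) = z i) ->
  substm g2 y0 (substm g1 x0 f) = substm g3 z0 f.
Proof.
move=> hg hx; rewrite -[LHS]/((substm g2 y0 \o substm g1 x0) f).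
apply: subst_uniq => [d h hh|c|i]; first exact: (subst_vanish g2 y0 (subst_vanish g1 x0 hh)).
  by rewrite -[LHS]/(substm g2 y0 (substm g1 x0 _)) !substC hg.
by rewrite -[LHS]/(substm g2 y0 (substm g1 x0 _)) substX hx.
Qed.

Notation idr L := (GRing.RMorphism.clone L L idfun _).

Lemma substm_id (L : fieldType) n (z : 'I_n -> {mfps L[n]})
    (z0 : forall i, vanish 1 (z i)) f :
  (forall i, z i = mfX i) -> substm (idr L) z0 f = f.
Proof.
move=> hz; rewrite -[RHS]/(idfun f); apply/esym.
by apply: (subst_uniq z0 (phi := idr {mfps L[n]})) => // i; rewrite hz.
Qed.

(** * Series in one variable and their order *)

Section Univariate.
Variable L : fieldType.
Implicit Types (f h z x : {mfps L[1]}).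

Definition tn (N : nat) : 'X_{1..1} := (U_(ord0) *+ N)%MM.
Definition tvar : {mfps L[1]} := mfX ord0.

Lemma mdeg_tn N : mdeg (tn N) = N.
Proof. by rewrite mdegMn mdeg1 mul1n. Qed.

Lemma tn_mdeg (m : 'X_{1..1}) : m = tn (mdeg m).
Proof.
apply/mnmP => i; rewrite mulmnE mnm1E [i]ord1 eqxx mul1n mdegE.
by rewrite big_ord_recl big_ord0 addn0.
Qed.

Lemma mfcoef_tvarXM N f : mfcoef (tvar ^+ N * f) (tn N) = mfcoef f 0%MM.
Proof. by rewrite -[tn N]addm0 mfcoef_mfXnM. Qed.

Lemma mmap1_tn N : mmap1 (@mfX 1 L) (tn N) = tvar ^+ N.
Proof.
by rewrite /mmap1 big_ord_recr big_ord0 /= mul1r mulmnE mnm1E [ord_max]ord1 eqxx mul1n.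
Qed.

Lemma vanish_tvarP d f : vanish d f -> exists h, f = tvar ^+ d * h.
Proof.
move=> hf; apply: mfps_divXn => m md; apply: hf.
by move: md; rewrite mdegE big_ord_recl big_ord0 addn0.
Qed.

Lemma vanish_tvarX d h : vanish d (tvar ^+ d * h).
Proof. by apply: vanishMr; apply: vanishX; apply: vanish_mfX. Qed.

Lemma mfps1_ord f : f != 0 ->
  exists e h, f = tvar ^+ e * h /\ mfcoef h 0%MM != 0.
Proof.
move=> f0; have : exists e, `[< mfcoef f (tn e) != 0 >].
  apply: contrapT => hf; case/eqP: f0; apply: mfpsP => m; rewrite mfcoef0.
  rewrite (tn_mdeg m); apply: contrapT => /eqP hm; apply: hf.
  by exists (mdeg m); apply/asboolP.
case/ex_minnP => e /asboolP fe emin; have hf : vanish e f.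
  move=> m me; apply: contrapT => /eqP hm; move: me; rewrite ltnNge => /negP.
  by apply; apply: emin; apply/asboolP; rewrite -tn_mdeg.
have [h fh] := vanish_tvarP hf; exists e, h; split=> //.
by move: fe; rewrite fh mfcoef_tvarXM.
Qed.

End Univariate.
Arguments tvar {L}.

(** * Series in T and Y, and splitting off powers of Y - x(T) *)

Section Bivariate.
Variable L : fieldType.
Local Notation P := {mfps L[1]}.
Local Notation B := {mfps L[2]}.

Definition sub2 m (a b : {mfps L[m]}) (i : 'I_2) : {mfps L[m]} :=
  if val i == 0%N then a else b.

Lemma sub2_0 m (a b : {mfps L[m]}) : vanish 1 a -> vanish 1 b ->
  forall i, vanish 1 (sub2 a b i).
Proof. by move=> ha hb i; rewrite /sub2; case: ifP. Qed.

Definition Tvar : B := mfX ord0.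
Definition Yvar : B := mfX ord_max.
Let T0 : vanish 1 Tvar := @vanish_mfX _ _ _.
Let Y0 : vanish 1 Yvar := @vanish_mfX _ _ _.
Let t0 : vanish 1 (tvar : P) := @vanish_mfX _ _ _.

(** Identifies L[[t]] with the series in T alone; [evB] is then a retraction onto it, and [shB] a
    change of the variable Y that fixes it. *)
Definition liftB : {rmorphism P -> B} := substm (idr L) (fun _ : 'I_1 => T0).

Lemma liftB0 x : vanish 1 x -> vanish 1 (liftB x).
Proof. exact: subst_vanish. Qed.

Definition evB z (z0 : vanish 1 z) : {rmorphism B -> P} :=
  substm (idr L) (sub2_0 t0 z0).
Definition shB w (w0 : vanish 1 w) : {rmorphism B -> B} :=
  substm (idr L) (sub2_0 T0 w0).

Lemma evBT z (z0 : vanish 1 z) : evB z0 Tvar = tvar.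
Proof. exact: substX. Qed.
Lemma evBY z (z0 : vanish 1 z) : evB z0 Yvar = z.
Proof. exact: substX. Qed.
Lemma shBT z (z0 : vanish 1 z) : shB z0 Tvar = Tvar.
Proof. exact: substX. Qed.
Lemma shBY z (z0 : vanish 1 z) : shB z0 Yvar = z.
Proof. exact: substX. Qed.

Lemma evB_lift z (z0 : vanish 1 z) x : evB z0 (liftB x) = x.
Proof.
rewrite /evB /liftB (substm_comp (g3 := idr L) _ (fun _ : 'I_1 => t0)) //.
  by apply: substm_id => i; rewrite [i]ord1.
by move=> i; apply: evBT.
Qed.

Lemma shB_lift z (z0 : vanish 1 z) x : shB z0 (liftB x) = liftB x.
Proof.
rewrite /shB /liftB (substm_comp (g3 := idr L) _ (fun _ : 'I_1 => T0)) //.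
by move=> i; apply: shBT.
Qed.

Lemma evB_cong d z z' (z0 : vanish 1 z) (z0' : vanish 1 z') H :
  vanish d (z - z') -> vanish d (evB z0 H - evB z0' H).
Proof.
move=> zz; apply: substm_cong => i; rewrite /sub2; case: ifP => // _.
by rewrite subrr; apply: vanish0.
Qed.

(** At Y = 0 only the powers of T survive, and distinct ones have distinct images, so the
    coefficient at [m] is not cancelled. *)
Lemma evB0_neq0 (H : B) (m : 'X_{1..2}) (z0 : vanish 1 (0 : P)) :
  m ord_max = 0%N -> mfcoef H m != 0 -> evB z0 H != 0.
Proof.
move=> m1 Hm; have md : mdeg m = m ord0.
  by rewrite mdegE !big_ord_recr big_ord0 /= add0n m1 addn0; congr (m _); apply: val_inj.
apply: contra_neq Hm => /(congr1 (fun f : P => mfcoef f (tn (m ord0)))).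
rewrite mfcoef0 /evB (@subst_coefE _ _ _ _ _ _ _ (mdeg m).+1) ?mdeg_tn ?md //.
have mb : (mdeg m < (m ord0).+1)%N by rewrite md.
have E (b : 'X_{1..2}) : mmap1 (sub2 tvar (0 : P)) b = tvar ^+ b ord0 * 0 ^+ b ord_max.
  rewrite /mmap1 !big_ord_recr big_ord0 /= mul1r.
  by congr (_ ^+ b _ * _ ^+ b _); apply: val_inj.
rewrite (bigD1 (BMultinom mb)) // big1 ?addr0 => [|b /andP[_]].
  by rewrite -[bmnm (BMultinom mb)]/m E m1 expr0 mfcoef_tvarXM mfcoefC eqxx mulr1 [X in X = _]addr0.
rewrite bmeqP -[bmnm (BMultinom mb)]/m => bm; rewrite E; have [b1|b1] := eqVneq (b ord_max) 0%N; last first.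
  by rewrite expr0n (negPf b1) mulr0n mulr0 mfcoef0 mulr0.
rewrite b1 expr0 mulr1 [X in _ * X](_ : _ = 0) ?mulr0 //.
rewrite -mmap1_tn mmap1_mfX /=; case: eqP => // /(congr1 (@mdeg _)); rewrite !mdeg_tn => e.
case/eqP: bm; apply/mnmP => i; rewrite (_ : i = if i == ord0 then ord0 else ord_max).
  by case: ifP; rewrite ?e ?b1 ?m1.
by case: ifP => [/eqP //|]; case: i => -[|[]] // *; apply: val_inj.
Qed.

(* Apply the automorphism Y |-> Y + x(T), divide by the largest power of Y, and
   shift back. *)
Lemma bivariate_factor (G : B) x (x0 : vanish 1 x) : G != 0 ->
  exists j H, G = (Yvar - liftB x) ^+ j * H /\ evB x0 H != 0.
Proof.
move=> G0.
have w0 : vanish 1 (Yvar + liftB x) by apply: vanishD (liftB0 x0).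
have w0' : vanish 1 (Yvar - liftB x) by apply: vanishB (liftB0 x0).
have z0 : vanish 1 (0 : P) by apply: vanish0.
have sK : cancel (shB w0) (shB w0').
  move=> h; rewrite /shB.
  rewrite (substm_comp (g3 := idr L) _ (sub2_0 T0 Y0)) // => [|i].
    apply: substm_id => i; rewrite /sub2.
    by case: ifP => h0; congr (mfX _); apply: val_inj; case: i h0 => -[|[]].
  rewrite -[substm _ _]/(shB w0') /sub2; case: ifP => _; first exact: shBT.
  by rewrite rmorphD shBY shB_lift subrK.
have ev_sh h : evB x0 (shB w0' h) = evB z0 h.
  apply: substm_comp => // i.
  rewrite -[substm _ _]/(evB x0) /sub2; case: ifP => _; first exact: evBT.
  by rewrite rmorphB evBY evB_lift subrr.
have sG : shB w0 G != 0 by apply: contra_neq G0 => e; rewrite -[G]sK e rmorph0.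
have : exists j, `[< exists2 m : 'X_{1..2}, m ord_max = j & mfcoef (shB w0 G) m != 0 >].
  have [m Gm _] := mfps_least sG.
  by exists (m ord_max); apply/asboolP; exists m.
case/ex_minnP => j /asboolP[m mj Gm] jmin.
have [a aj|h Gh] := @mfps_divXn 2 L ord_max j (shB w0 G).
  apply: contrapT => /eqP Ga; move: aj; rewrite ltnNge => /negP; apply.
  by apply: jmin; apply/asboolP; exists a.
exists j, (shB w0' h); split.
  by rewrite -[LHS]sK Gh rmorphM rmorphXn; congr (_ ^+ _ * _); apply: shBY.
(* Evaluating at Y = x after shifting back amounts to evaluating h at Y = 0, and dividing the
   monomial [m] by Y^j gives a monomial of h free of Y. *)
rewrite ev_sh; apply: (@evB0_neq0 _ (m - U_(ord_max) *+ j)).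
  by rewrite mnmBE mulmnE mnm1E eqxx mul1n mj subnn.
have em : m = (U_(ord_max) *+ j + (m - U_(ord_max) *+ j))%MM.
  rewrite addmC submK //; apply/mnm_lepP => i; rewrite mulmnE mnm1E.
  by case: eqP => [<-|]; rewrite ?mul1n ?mj ?mul0n.
by move: Gm; rewrite Gh {1}em mfcoef_mfXnM.
Qed.

End Bivariate.

(** * Analytic independence *)

Section Growth.
Variables (k L : fieldType) (g : {rmorphism k -> L}) (u : L).
Hypothesis u_tr : forall p : {poly k}, (map_poly g p).[u] = 0 -> p = 0.

Definition evu : {rmorphism {poly k} -> L} :=
  GRing.RMorphism.clone _ _ (horner_eval u \o map_poly g) _.

Lemma evuE p : evu p = (map_poly g p).[u].
Proof. by []. Qed.

Lemma evuC c : evu c%:P = g c.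
Proof. by rewrite evuE map_polyC hornerC. Qed.

Lemma evuX : evu 'X = u.
Proof. by rewrite evuE map_polyX hornerX. Qed.

Lemma evu_eq0 p : evu p = 0 -> p = 0.
Proof. exact: u_tr. Qed.

Lemma evu_neq0 p : p != 0 -> evu p != 0.
Proof. by apply: contra_neq => /evu_eq0. Qed.

(** The coefficients are a function on L, so a repeated entry would count with its multiplicity,
    which may be zero in k; [undup] prevents this. *)
Definition kspan (Z : seq L) (v : L) :=
  exists c : L -> k, v = \sum_(z <- undup Z) g (c z) * z.

Lemma kspan_mem Z z : z \in Z -> kspan Z z.
Proof.
move=> zZ; exists (fun y => (y == z)%:R).
rewrite (bigD1_seq z) ?mem_undup ?undup_uniq //= eqxx rmorph1 mul1r big1 ?addr0 //.
by move=> y /negPf ->; rewrite rmorph0 mul0r.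
Qed.

Lemma kspan_sum (I : finType) Z (c : I -> k) (f : I -> L) :
  (forall i, f i \in Z) -> kspan Z (\sum_i g (c i) * f i).
Proof.
move=> fZ; elim/big_rec: _ => [|i v _ [d ->]].
  by exists (fun _ => 0); rewrite big1 // => z _; rewrite rmorph0 mul0r.
have [d' ->] := kspan_mem (fZ i); exists (fun z => c i * d' z + d z).
rewrite mulr_sumr -big_split; apply: eq_bigr => z _ /=.
by rewrite rmorphD rmorphM mulrDl mulrA.
Qed.

Lemma kspan_catl Z1 Z2 v : kspan Z1 v -> kspan (Z1 ++ Z2) v.
Proof.
move=> [c ->]; rewrite big_tnth; apply: (@kspan_sum _ _ (fun i => c (tnth _ i))) => i.
by rewrite mem_cat -mem_undup mem_tnth.
Qed.

Lemma kspan_catr Z1 Z2 v : kspan Z2 v -> kspan (Z1 ++ Z2) v.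
Proof.
move=> [c ->]; rewrite big_tnth; apply: (@kspan_sum _ _ (fun i => c (tnth _ i))) => i.
by rewrite mem_cat -(mem_undup Z2) mem_tnth orbT.
Qed.

Lemma kspan_scale a Z v : kspan Z v -> kspan [seq a * z | z <- Z] (a * v).
Proof.
move=> [c ->]; rewrite mulr_sumr big_tnth.
rewrite (eq_bigr (fun i => g (c (tnth (in_tuple (undup Z)) i)) *
    (a * tnth (in_tuple (undup Z)) i))) => [|i _]; last by rewrite mulrCA.
apply: (@kspan_sum _ _ (fun i => c (tnth _ i))) => i.
by apply: map_f; rewrite -mem_undup mem_tnth.
Qed.

Definition polyfree r (e : nat -> L) := forall P : nat -> {poly k},
  \sum_(l < r) evu (P l) * e l = 0 -> forall l, (l < r)%N -> P l = 0.

(* A finite-dimensional k-subspace has coordinates of bounded degree in some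
   k[u]-free family, so multiplication by a large power of u moves it off itself. *)
Lemma kspan_coords Z : exists r (e : nat -> L) D, polyfree r e /\
  forall v, kspan Z v -> exists P : nat -> {poly k},
    (forall l, (l < r)%N -> (size (P l) <= D)%N) /\ v = \sum_(l < r) evu (P l) * e l.
Proof.
elim: Z => [|b Z [r [e [D [free coord]]]]].
  exists 0%N, (fun _ => 0), 0%N; split=> [P _ l //|v [c ->]].
  by exists (fun _ => 0); rewrite big_nil big_ord0.
have [bZ|bZ] := boolP (b \in Z).
  by exists r, e, D; split=> // v [c]; rewrite /= bZ => vE; apply: coord; exists c.
have step v : kspan (b :: Z) v -> exists c w, kspan Z w /\ v = g c * b + w.
  move=> [c]; rewrite /= (negPf bZ) big_cons => ->.
  by exists (c b), (\sum_(z <- undup Z) g (c z) * z); split=> //; exists c.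
have [[P [Q [Q0 PQ]]]|indep] := pselect (exists (P : nat -> {poly k}) Q,
    Q != 0 /\ \sum_(l < r) evu (P l) * e l + evu Q * b = 0).
  (* If b depends on the family over k[u], dividing the family by Q(u) brings b into its k[u]-span,
     at the cost of a larger degree bound. *)
  have evQ := evu_neq0 Q0.
  exists r, (fun l => e l / evu Q), (D + size Q + \max_(l < r) size (P l))%N.
  split=> [R RE|v /step[c [w [/coord[R [Rs ->]] ->]]]].
    apply: free; apply: (mulIf (invr_neq0 evQ)); rewrite mul0r -[RHS]RE mulr_suml.
    by apply: eq_bigr => l _; rewrite mulrA.
  exists (fun l => R l * Q - c *: P l); split=> [l lr|].
    apply: leq_trans (size_polyD _ _) _; rewrite geq_max size_polyN; apply/andP; split.
      apply: leq_trans (leq_addr _ _); apply: leq_trans (size_polyMleq _ _) _.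
      by apply: leq_trans (leq_pred _) _; rewrite leq_add2r Rs.
    apply: leq_trans (size_scale_leq _ _) _; apply: leq_trans (leq_addl _ _).
    exact: (leq_bigmax (Ordinal lr)).
  have -> : b = - \sum_(l < r) evu (P l) * (e l / evu Q).
    apply: (mulfI evQ); apply/eqP; rewrite -subr_eq0 mulrN opprK addrC; apply/eqP.
    rewrite -[RHS]PQ mulr_sumr; congr (_ + _); apply: eq_bigr => l _.
    by rewrite mulrCA [evu Q * _]mulrC divfK.
  rewrite mulrN mulr_sumr addrC -sumrB; apply: eq_bigr => l _.
  rewrite rmorphB rmorphM -mul_polyC rmorphM evuC mulrBl !mulrA; congr (_ - _).
  by rewrite mulrAC mulfK.
(* Otherwise b joins the family at index r; its coordinates are constants, of size at most 1. *)
pose e' (l : nat) : L := if l == r then b else e l; exists r.+1, e', (maxn D 1).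
have sumE (P : nat -> {poly k}) : \sum_(l < r.+1) evu (P l) * e' l =
     \sum_(l < r) evu (P l) * e l + evu (P r) * b.
  rewrite big_ord_recr /= {2}/e' eqxx; congr (_ + _).
  by apply: eq_bigr => l _; rewrite /e' ltn_eqF.
split=> [P|v /step[c [w [/coord[R [Rs ->]] ->]]]].
  move=> PE; have {}PE := etrans (esym (sumE P)) PE; have Pr : P r = 0.
    by apply: contrapT => /eqP Pr; apply: indep; exists P, (P r).
  move=> l; rewrite ltnS leq_eqVlt => /orP[/eqP -> //|lr].
  by apply: free lr; move: PE; rewrite Pr rmorph0 mul0r addr0.
pose R' (l : nat) := if l == r then c%:P else R l; exists R'; rewrite /R'; split.
  move=> l; rewrite ltnS leq_eqVlt; case: eqP => [_ _|_ /= lr].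
    by rewrite leq_max size_polyC leq_b1 orbT.
  by rewrite leq_max Rs.
apply: (etrans _ (esym (sumE R'))); rewrite /R' eqxx evuC addrC; congr (_ + _).
by apply: eq_bigr => l _; rewrite ltn_eqF.
Qed.

(** Coordinates in a k[u]-free family are unique. Those of w have size at most D, while u^M v has a
    coordinate of size greater than M. *)
Lemma kspan_growth Z : exists D, forall M, (D <= M)%N -> forall v w,
  kspan Z v -> kspan Z w -> v != 0 -> u ^+ M * v != w.
Proof.
have [r [e [D [free coord]]]] := kspan_coords Z; exists D => M DM v w.
move=> /coord[P [_ ->]] /coord[R [Rs ->]]; apply: contra_neq => E.
apply: big1 => l _; rewrite [P l](_ : _ = 0) ?rmorph0 ?mul0r //.
have /(_ l (ltn_ord l)) : forall l, (l < r)%N -> 'X^M * P l - R l = 0.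
  apply: (free (fun l => 'X^M * P l - R l)); apply/eqP.
  rewrite (eq_bigr (fun l : 'I_r => u ^+ M * (evu (P l) * e l) - evu (R l) * e l)).
    by rewrite sumrB -mulr_sumr E subrr.
  by move=> i _; rewrite rmorphB rmorphM rmorphXn evuX mulrBl mulrA.
move/eqP; rewrite subr_eq0 => /eqP PR; apply/eqP; apply: contraT => P0.
have := Rs l (ltn_ord l); rewrite -PR mulrC size_mulXn // leqNgt.
by rewrite (leq_ltn_trans DM) // -[ltnLHS]addn0 ltn_add2l lt0n size_poly_eq0.
Qed.

(** The forbidden relation reads u^(M j) (b^j v) = a^j w inside the span of b^j [S1] and a^j [S2].
    Since j > 0, the exponent M j is at least M, and the maximum of the bounds serves all j up to
    n. *)
Lemma kspan_avoid (S1 S2 : seq L) (b a : L) n : b != 0 -> exists M, forall j,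
  (0 < j <= n)%N -> forall v w, kspan S1 v -> kspan S2 w -> v != 0 ->
  v * (b * u ^+ M) ^+ j != a ^+ j * w.
Proof.
move=> b0; have [D hD] := choice (fun j =>
  kspan_growth ([seq b ^+ j * z | z <- S1] ++ [seq a ^+ j * z | z <- S2])).
exists (\max_(j < n.+1) D j) => j /andP[j0 jn] v w hv hw v0.
rewrite exprMn -exprM mulrCA mulrA [X in X != _]mulrC; apply: hD.
- have jn' : (j < n.+1)%N by [].
  apply: leq_trans (leq_pmulr _ j0).
  exact: (@leq_bigmax _ (fun i : 'I_n.+1 => D i) (Ordinal jn')).
- by apply/kspan_catl/kspan_scale.
- by apply/kspan_catr/kspan_scale.
- by rewrite mulf_neq0 // expf_neq0.
Qed.

End Growth.

(** * Coefficients of F(t, ut, z) for z close to a root *)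

Section Independence.
Variables (k L : fieldType) (g : {rmorphism k -> L}) (u : L).
Hypothesis u_tr : forall p : {poly k}, (map_poly g p).[u] = 0 -> p = 0.
Local Notation A := {mfps k[3]}.
Local Notation P := {mfps L[1]}.
Local Notation B := {mfps L[2]}.

Definition sub3 m (a b c : {mfps L[m]}) (i : 'I_3) : {mfps L[m]} :=
  if val i == 0%N then a else if val i == 1%N then b else c.

Lemma sub3_0 m (a b c : {mfps L[m]}) : vanish 1 a -> vanish 1 b -> vanish 1 c ->
  forall i, vanish 1 (sub3 a b c i).
Proof. by move=> ha hb hc i; rewrite /sub3; case: ifP => // _; case: ifP. Qed.

Let T0 : vanish 1 (Tvar L) := @vanish_mfX _ _ _.
Let Y0 : vanish 1 (Yvar L) := @vanish_mfX _ _ _.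
Let t0 : vanish 1 (tvar : P) := @vanish_mfX _ _ _.
Let uT0 : vanish 1 (mfpsC 2 u * Tvar L) := vanishMl (mfpsC 2 u) T0.
Let ut0 : vanish 1 (mfpsC 1 u * tvar : P) := vanishMl (mfpsC 1 u) t0.

(* X_1, X_2, X_3 |-> T, u T, Y. *)
Definition iota3 : {rmorphism A -> B} := substm g (sub3_0 T0 uT0 Y0).

Definition Phi z (z0 : vanish 1 z) : {rmorphism A -> P} :=
  substm g (sub3_0 t0 ut0 z0).

Lemma Phi_iota z (z0 : vanish 1 z) F : Phi z0 F = evB z0 (iota3 F).
Proof.
apply/esym; apply: substm_comp => // i.
rewrite -[substm _ _]/(evB z0) /sub3; case: ifP => _; first exact: evBT.
case: ifP => _; last exact: evBY.
by rewrite rmorphM evBT; congr (_ * _); apply: substC.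
Qed.

(** The monomial with exponents (a, b, c) goes to u^b T^(a+b) Y^c. Monomials with the same power of
    T and Y differ in b, so each coefficient of the image is the value at u of a polynomial whose
    coefficients are coefficients of F. *)
Lemma iota3_inj F : iota3 F = 0 -> F = 0.
Proof.
move=> F0; apply: mfpsP => b; rewrite mfcoef0.
pose c (d : 'X_{1..3}) : 'X_{1..2} := [multinom
  if i == ord0 then (d (inord 0) + d (inord 1))%N else d (inord 2) | i < 2].
have mdegc d : mdeg (c d) = mdeg d.
  rewrite !mdegE !big_ord_recl !big_ord0 !mnmE /= !addn0 addnA.
  by congr (d _ + d _ + d _)%N; apply: val_inj; rewrite /= inordK.
have E d : mmap1 (sub3 (Tvar L) (mfpsC 2 u * Tvar L) (Yvar L)) d =
    mfpsC 2 (u ^+ d (inord 1)) * mmap1 (@mfX 2 L) (c d).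
  have i0 : ord0 = inord 0 :> 'I_3 by apply: val_inj; rewrite /= inordK.
  have i1 : lift ord0 ord0 = inord 1 :> 'I_3 by apply: val_inj; rewrite /= inordK.
  have i2 : lift ord0 (lift ord0 ord0) = inord 2 :> 'I_3.
    by apply: val_inj; rewrite /= inordK.
  have l1 : lift ord0 ord0 = ord_max :> 'I_2 by apply: val_inj.
  rewrite /mmap1 !big_ord_recl !big_ord0 !mulr1 i2 i1 i0 l1 /sub3 /= !inordK //=.
  rewrite !mnmE /= exprMn rmorphXn exprD -/(Tvar L) -/(Yvar L).
  have acd (R : comNzRingType) (x y z w : R) : x * (y * z * w) = y * (x * z * w).
    by rewrite !mulrA [y * x]mulrC.
  exact: acd.
pose D := (mdeg b).+1; have bD : (mdeg b < D)%N by [].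
pose q : {poly k} := \sum_(d : 'X_{1..3 < D} | c d == c b)
  mfcoef F d *: 'X^(d (inord 1)).
have q0 : q = 0.
  apply: u_tr; rewrite /q raddf_sum horner_sum.
  transitivity (mfcoef (iota3 F) (c b)); last by rewrite F0 mfcoef0.
  rewrite /iota3 (@subst_coefE _ _ _ _ _ _ _ D) ?mdegc // big_mkcond.
  apply: eq_bigr => d _; rewrite E mfcoefCM mmap1_mfX.
  rewrite -[mfcoef _ (c b)]/((c b == c d)%:R) [c b == _]eq_sym; case: ifP => _; last by rewrite !mulr0.
  by rewrite /= map_polyZ map_polyXn hornerZ hornerXn mulr1.
have := congr1 (fun q : {poly k} => q`_(b (inord 1))) q0.
rewrite coef0 coef_sum (bigD1 (BMultinom bD)) //= coefZ coefXn eqxx mulr1.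
rewrite big1 ?addr0 // => d /andP[/eqP cd db]; rewrite coefZ coefXn.
case: eqP => [e1|_]; last by rewrite mulr0.
case/negP: db; rewrite bmeqP; apply/eqP/mnmP => i.
have := congr1 (fun m : 'X_{1..2} => m ord0) cd; rewrite !mnmE /= e1 => /addIn e0.
have := congr1 (fun m : 'X_{1..2} => m ord_max) cd; rewrite !mnmE /= => e2.
rewrite -[i]inord_val; case: i => -[|[|[|]]] //= _; rewrite ?e0 ?e1 ?e2 //.
Qed.

(** In the factorization (Y - x)^j H, the first factor becomes t^(jn) (- eps)^j at Y = z. Since n >
    e, H(t, z) and H(t, x) agree up to t^e, where c is the leading coefficient of H(t, x). *)
Lemma Phi_cong_coef F x (x0 : vanish 1 x) : F != 0 -> Phi x0 F = 0 ->
  exists j e c, [/\ (0 < j)%N, c != 0 & forall n z (z0 : vanish 1 z) eps,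
    (e < n)%N -> x - z = tvar ^+ n * eps ->
    mfcoef (Phi z0 F) (tn (j * n + e)) = (- mfcoef eps 0%MM) ^+ j * c].
Proof.
move=> F0 PF; have G0 : iota3 F != 0 by apply: contra_neq F0 => /iota3_inj.
have [j [H [GH Hx]]] := bivariate_factor x0 G0.
have [e [h [eh h0]]] := mfps1_ord Hx.
exists j, e, (mfcoef h 0%MM); split=> // [|n z z0 eps en xz].
  (* For j = 0 the series F(t, ut, x) would be H(t, x), which is not zero. *)
  rewrite lt0n; apply: contraNneq Hx => j0; move: PF.
  by rewrite Phi_iota GH j0 expr0 mul1r => ->.
have zx : z - x = tvar ^+ n * (- eps) by rewrite mulrN -xz opprB.
have [h' eh'] : exists h', evB z0 H = tvar ^+ e * h'.
  apply: vanish_tvarP; rewrite -[evB z0 H](subrK (evB x0 H)); apply: vanishD.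
    by apply: (vanishW (ltnW en)); apply: evB_cong; rewrite zx; apply: vanish_tvarX.
  by rewrite eh; apply: vanish_tvarX.
have h'0 : mfcoef h' 0%MM = mfcoef h 0%MM.
  rewrite -!(mfcoef_tvarXM e) -eh -eh'; apply/eqP; rewrite -subr_eq0 -mfcoefB.
  suff -> : mfcoef (evB z0 H - evB x0 H) (tn e) = 0 by [].
  apply: (@evB_cong _ n) => //; first by rewrite zx; apply: vanish_tvarX.
  by rewrite mdeg_tn.
rewrite Phi_iota GH rmorphM rmorphXn rmorphB evBY evB_lift zx eh' exprMn.
rewrite -exprM mulnC mulrACA -exprD mfcoef_tvarXM mfcoefM0 h'0; congr (_ * _).
by elim: j {GH} => [|j ih]; rewrite ?exprS ?mfcoefM0 ?ih // !expr0 mfcoefC eqxx.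
Qed.

End Independence.

(** * A series analytically independent of t and ut *)

Section Series.
Variables (k L : fieldType) (g : {rmorphism k -> L}) (u : L).
Hypothesis u_tr : forall p : {poly k}, (map_poly g p).[u] = 0 -> p = 0.
Local Notation A := {mfps k[3]}.
Local Notation P := {mfps L[1]}.

Definition ser (a : nat -> L) : P :=
  MFPS (fun m => if mdeg m is d.+1 then a d else 0).

Lemma ser0 a : vanish 1 (ser a).
Proof. by apply/vanish1P; rewrite /= mdeg0. Qed.

Lemma serB a b n : (forall i, (i < n)%N -> a i = b i) ->
  (forall i, (n <= i)%N -> b i = 0) ->
  ser a - ser b = tvar ^+ n.+1 * MFPS (fun m => a (n + mdeg m)%N).
Proof.
move=> ab b0; have h : vanish n.+1 (ser a - ser b).
  move=> m; rewrite mfcoefB /=; case: (mdeg m) => [|d]; first by rewrite subrr.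
  by rewrite ltnS => dn; rewrite ab // subrr.
have [h' hE] := vanish_tvarP h; rewrite hE; congr (_ * _); apply: mfpsP => m.
rewrite -(mfcoef_mfXnM ord0 n.+1 h' m) -hE mfcoefB /= mdegD mdegMn mdeg1 mul1n.
by rewrite addSn b0 ?subr0 ?leq_addr.
Qed.

(** Spans the coefficients of index below D of F(t, ut, z) for all F at once, since only monomials
    of degree below D contribute to them. *)
Definition coef_list (z : P) D : seq L :=
  [seq mfcoef (mmap1 (sub3 tvar (mfpsC 1 u * tvar) z) (bmnm b)) (tn N)
     | b <- enum {: 'X_{1..3 < D}}, N <- iota 0 D].

Lemma Phi_kspan z (z0 : vanish 1 z) D F N : (N < D)%N ->
  kspan g (coef_list z D) (mfcoef (Phi g u z0 F) (tn N)).
Proof.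
move=> ND; rewrite /Phi (@subst_coefE _ _ _ _ _ _ _ D) ?mdeg_tn //.
apply: (@kspan_sum _ _ g _ _ (fun b : 'X_{1..3 < D} => mfcoef F b)) => b.
by apply: allpairs_f; rewrite ?mem_enum // mem_iota.
Qed.

(* The exponents M n are chosen one after the other, so large that no relation
   v (a n.+1)^j = (a n)^j w can hold between coefficients v, w of F(t, ut, z) at
   the partial sums z of order n and n.+1. *)
Lemma independent_series (beta : nat -> L) : (forall n, beta n != 0) ->
  exists M : nat -> nat, let a n := beta n * u ^+ M n in
    forall F : A, Phi g u (ser0 a) F = 0 -> F = 0.
Proof.
move=> beta0.
pose restr m (p : nat -> L) i := if (i < m)%N then p i else 0.
pose S n p := coef_list (ser p) (n.+1 * n.+1).
(* The exponent at position [q.1] is a function of the coefficients [q.2] chosen before it. For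
   [q.1] = 0 there is no j to exclude, so the truncated predecessor is harmless. *)
have [Mf MfP] := choice (fun q : nat * (nat -> L) =>
  kspan_avoid u_tr (S q.1.-1 (restr q.1.-1 q.2)) (S q.1 q.2) (q.2 q.1.-1) q.1
    (beta0 q.1)).
(* [pre n] carries the first n coefficients, padded with zeros, and feeds them to the next
   choice. *)
pose pre := fix pre n i : L := if n is n'.+1 then
  if i == n' then beta n' * u ^+ Mf (n', pre n') else pre n' i else 0.
exists (fun n => Mf (n, pre n)) => a F PF.
have preE n i : pre n i = if (i < n)%N then a i else 0.
  elim: n => [|n ih] //=; rewrite ltnS leq_eqVlt.
  by case: eqP => [->|_] //=.
apply/eqP; apply: contraT => F0.
have [j [e [c [j0 c0 cE]]]] := Phi_cong_coef u_tr F0 PF.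
pose n := maxn e j.
have en : (e <= n)%N by rewrite leq_maxl.
have jn : (j <= n)%N by rewrite leq_maxr.
have coefE q : (n <= q)%N ->
    mfcoef (Phi g u (ser0 (pre q)) F) (tn (j * q.+1 + e)) = (- a q) ^+ j * c.
  move=> nq; rewrite (cE q.+1 _ (ser0 (pre q)) (MFPS (fun m => a (q + mdeg m)%N))).
  - by rewrite /= mdeg0 addn0.
  - by rewrite ltnS (leq_trans en).
  by apply: serB => i; rewrite preE => iq; rewrite ?iq // ltnNge iq.
(* The index j (q+1) + e stays below the bound (q+1)^2 built into [S] because e and j are at most
   q. *)
have span q : (n <= q)%N -> kspan g (S q (pre q)) ((- a q) ^+ j * c).
  move=> nq; rewrite -coefE //; apply: Phi_kspan.
  rewrite [ltnRHS]mulSn addnC -addSn leq_add //.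
    by rewrite ltnS (leq_trans en).
  by rewrite leq_mul2r (leq_trans jn).
have pre_restr : pre n = restr n (pre n.+1).
  apply: funext => i; rewrite /restr !preE; case: ltnP => // iN.
  by rewrite ltnS ltnW.
have an0 : a n != 0.
  rewrite /a mulf_neq0 ?expf_neq0 //; apply/eqP => u0.
  have /eqP : 'X = 0 :> {poly k} by apply: u_tr; rewrite map_polyX hornerX.
  by rewrite polyX_eq0.
have jn1 : (0 < j <= n.+1)%N by rewrite j0 (leq_trans jn).
(* The coefficients v = (- a_n)^j c and w = (- a_(n+1))^j c satisfy v a_(n+1)^j = a_n^j w, the
   relation that the choice of the exponent at n+1 excludes. *)
have := MfP (n.+1, pre n.+1) j jn1 ((- a n) ^+ j * c) ((- a n.+1) ^+ j * c).
rewrite -[(n.+1, _).2]/(pre n.+1) -[(n.+1, _).1]/n.+1 -[n.+1.-1]/n.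
rewrite -pre_restr preE ltnSn => /(_ (span n (leqnn n)) (span n.+1 (leqnSn n))).
have neg (x y : L) : (- x) ^+ j * c * y ^+ j = x ^+ j * ((- y) ^+ j * c).
  by rewrite (exprNn x) (exprNn y) -!mulrA mulrCA [c * _]mulrC.
have v0 : (- a n) ^+ j * c != 0 by rewrite mulf_neq0 // expf_neq0 // oppr_eq0.
move=> /(_ v0); change (beta n.+1 * _) with (a n.+1).
by rewrite (neg (a n)) eqxx.
Qed.

End Series.

(** * Residues of an adically closed subring *)

(** Induction on p avoids dividing by 2, so this holds in every characteristic. *)
Lemma horner_taylor2 (R : comNzRingType) (p : {poly R}) x h :
  exists s, p.[x + h] = p.[x] + p^`().[x] * h + s * h ^+ 2.
Proof.
elim/poly_ind: p => [|p c [s IH]].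
  by exists 0; rewrite deriv0 !horner0 !mul0r !addr0.
exists (s * (x + h) + p^`().[x]); rewrite derivD derivC derivM derivX mulr1 addr0.
rewrite !hornerD !hornerM !hornerC !hornerX IH.
by ring.
Qed.

(** Here c is the root, h the current error, d and d + w h the derivative at c and at c + h, and i
    the inverse of the latter: the new error is a multiple of h^2. *)
Lemma newton_step (R : comNzRingType) (c h d s w i : R) : (d + w * h) * i = 1 ->
  c + h - (d * h + s * h ^+ 2) * i - c = (w - s) * i * (h * h).
Proof.
move=> e; apply: subr0_eq; transitivity (h * (1 - (d + w * h) * i)); first by ring.
by rewrite e subrr mulr0.
Qed.

Section Residues.
Variables (k L : fieldType) (g : {rmorphism k -> L}) (u : L).
Local Notation P := {mfps L[1]}.
(** To be instantiated with the t-adic closure of the image of the quotient field. *)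
Variable D : P -> Prop.
Hypotheses (D1 : D 1) (DB : forall f h, D f -> D h -> D (f - h)).
Hypotheses (DM : forall f h, D f -> D h -> D (f * h)).
Hypothesis DV : forall f, D f -> mfcoef f 0%MM != 0 -> D f^-1.
Hypotheses (Dt : D tvar) (Dtd : forall f, D (tvar * f) -> D f).
Hypothesis Dcl : forall f, (forall N, exists h, D h /\ vanish N (h - f)) -> D f.
Hypotheses (Dk : forall c, D (mfpsC 1 (g c))) (Du : D (mfpsC 1 u)).

Let D0 : D 0. Proof. by rewrite -(subrr 1); apply: DB. Qed.
Let DD f h : D f -> D h -> D (f + h).
Proof. by move=> df dh; rewrite -[h]opprK -[- h]sub0r; apply/DB/DB. Qed.
Let DX f n : D f -> D (f ^+ n).
Proof. by move=> df; elim: n => [|n ih]; rewrite ?expr0 ?exprS //; apply: DM. Qed.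
Let DMn f n : D f -> D (f *+ n).
Proof. by move=> df; elim: n => [|n ih]; rewrite ?mulr0n ?mulrS //; apply: DD. Qed.
Let Dsum n (F : 'I_n -> P) : (forall i, D (F i)) -> D (\sum_i F i).
Proof. by move=> h; elim/big_ind: _. Qed.
Let DtdX n f : D (tvar ^+ n * f) -> D f.
Proof.
by elim: n => [|n ih]; rewrite ?mul1r // exprS -mulrA => /Dtd/ih.
Qed.

Let Dhorner (p : {poly P}) y : (forall i, D p`_i) -> D y -> D p.[y].
Proof.
by move=> hp hy; rewrite horner_coef; apply: Dsum => i; apply/DM/DX.
Qed.

(** Newton's iteration started at f stays in D and converges to the constant b, because the
    derivative at each iterate has constant term Q'(b) and is therefore invertible. *)
Lemma newton_const (Q : {poly L}) f b : D f -> mfcoef f 0%MM = b ->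
  (forall i, D (mfpsC 1 Q`_i)) -> Q.[b] = 0 -> Q^`().[b] != 0 -> D (mfpsC 1 b).
Proof.
move=> Df fb hQ Qb Q'b; pose QC := map_poly (@mfpsC 1 L) Q.
have DQ y : D y -> D QC.[y] by apply: Dhorner => i; rewrite coef_map; apply: hQ.
have DQ' y : D y -> D QC^`().[y].
  by apply: Dhorner => i; rewrite coef_deriv coef_map; apply: DMn (hQ _).
have ex N : exists h, D h /\ vanish N.+1 (h - mfpsC 1 b).
  elim: N => [|N [y [Dy yb]]].
    by exists f; split=> //; apply/vanish1P; rewrite -fb mfps_coef0_sub.
  set h := y - mfpsC 1 b in yb; have yE : y = mfpsC 1 b + h by rewrite addrC subrK.
  have [s sE] := horner_taylor2 QC (mfpsC 1 b) h.
  have [s' s'E] := horner_taylor2 QC^`() (mfpsC 1 b) h.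
  have Q0 : QC.[mfpsC 1 b] = 0 by rewrite horner_map Qb rmorph0.
  have Q'0 : QC^`().[mfpsC 1 b] = mfpsC 1 Q^`().[b] by rewrite deriv_map horner_map.
  rewrite -yE Q0 add0r in sE; rewrite -yE in s'E.
  set d := QC^`().[mfpsC 1 b] in sE s'E Q'0.
  pose w := QC^`()^`().[mfpsC 1 b] + s' * h.
  have {}s'E : QC^`().[y] = d + w * h by rewrite s'E -addrA mulrDl expr2 mulrA.
  have h0 : mfcoef h 0%MM = 0 by apply: yb; rewrite mdeg0.
  have Q'y : mfcoef QC^`().[y] 0%MM != 0.
    by rewrite s'E mfcoefD mfcoefM0 h0 mulr0 addr0 Q'0 mfcoefC eqxx.
  have Uy : QC^`().[y] \is a GRing.unit by rewrite mfps_unitE.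
  exists (y - QC.[y] / QC^`().[y]); split; first by apply: DB => //; apply: DM (DV _ _); auto.
  rewrite (_ : _ - _ = (w - s) / QC^`().[y] * (h * h)).
    apply: vanishMl; apply: (@vanishW _ _ (N.+1 + N.+1)); last exact: vanishM.
    by rewrite addSn addnS ltnS ltnS leq_addr.
  by rewrite sE {1}yE; apply: newton_step; rewrite -s'E divrr.
apply: Dcl => N; have [h [Dh hb]] := ex N; exists h; split=> //.
exact: vanishW (leqnSn N) hb.
Qed.

Definition res (b : L) := exists f, D f /\ mfcoef f 0%MM = b.

Lemma res_const b : D (mfpsC 1 b) -> res b.
Proof. by move=> Db; exists (mfpsC 1 b); rewrite mfcoefC eqxx. Qed.

Lemma resM b c : res b -> res c -> res (b * c).
Proof.
move=> [f [Df <-]] [h [Dh <-]]; exists (f * h); rewrite mfcoefM0.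
by split=> //; apply: DM.
Qed.

Lemma resB b c : res b -> res c -> res (b - c).
Proof. by move=> [f [Df <-]] [h [Dh <-]]; exists (f - h); split=> //; apply: DB. Qed.

Lemma resV b : res b -> res b^-1.
Proof.
move=> [f [Df <-]]; have [->|f0] := eqVneq (mfcoef f 0%MM) 0.
  by rewrite invr0; exists 0; rewrite mfcoef0.
exists f^-1; split; first exact: DV.
apply: (mulfI f0); rewrite -mfcoefM0 divrr ?mfps_unitE // divff //.
by rewrite -[1]/(mfpsC 1 1) mfcoefC eqxx.
Qed.

Section Generators.
Variables (b beta : nat -> L) (r M : nat -> nat).
Let q n := (\prod_(i < n) r i)%N.
Hypotheses (r_pchar : forall n, [pchar L].-nat (r n)) (u0 : u != 0).
Hypothesis betaE : forall n, beta n ^+ q n = b n.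
Hypothesis b_sep : forall n, exists Q : {poly {poly k}},
  (map_poly (evu g u) Q).[b n ^+ r n] = 0 /\
  (map_poly (evu g u) Q)^`().[b n ^+ r n] != 0.
Let a n := beta n * u ^+ M n.
Hypothesis Dx : D (ser a).

Let q_pchar n : [pchar P].-nat (q n).
Proof.
have : [pchar L].-nat (q n).
  rewrite /q; elim/big_ind: _ => // x y; rewrite pnatM; by move=> -> ->.
by apply: sub_in_pnat => p _; apply: (rmorph_pchar (@mfpsC 1 L)).
Qed.

(* The induction below keeps the q n-th power of this tail in D. *)
Let tail n i := if (i < n)%N then 0 else a i.

Let tail_rec n : ser (tail n) = mfpsC 1 (a n) * tvar ^+ n.+1 + ser (tail n.+1).
Proof.
apply: mfpsP => m; rewrite mfcoefD mfcoefCM (tn_mdeg m) -[_ ^+ _]mulr1.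
have [/eqP e|ne] := eqVneq (mdeg m) n.+1.
  rewrite (eqP e) mfcoef_tvarXM -[1]/(mfpsC 1 1) mfcoefC eqxx mulr1.
  by rewrite /= !mdeg_tn /tail ltnn ltnSn addr0.
rewrite [X in _ * X](_ : _ = 0) ?mulr0 ?add0r.
  rewrite /= mdeg_tn; case: (mdeg m) ne => // d; rewrite eqSS /tail ltnS => dn.
  by rewrite [(d <= n)%N]leq_eqVlt (negPf dn).
rewrite mulr1 -mmap1_tn mmap1_mfX /=; case: eqP => // /(congr1 (@mdeg _)).
by rewrite !mdeg_tn => e; rewrite e eqxx in ne.
Qed.

Let Devu c : D (mfpsC 1 (evu g u c)).
Proof.
rewrite evuE horner_coef rmorph_sum; apply: Dsum => j.
by rewrite rmorphM rmorphXn coef_map; apply: DM; [apply: Dk|apply/DX/Du].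
Qed.

(** The [q n]-th power of the tail has leading coefficient b_n u^(M_n q_n), which makes b_n a
    residue. Then b_n^(r_n) is a separable residue, hence a constant in D, and the leading term can
    be removed after raising to the power r_n. *)
Lemma res_gen n : res (b n).
Proof.
have a_q m : a m ^+ q m = b m * u ^+ (M m * q m) by rewrite exprMn betaE exprM.
suff main : D (ser (tail n) ^+ q n) /\ res (b n) by case: main.
have step m : D (ser (tail m) ^+ q m) -> res (b m).
  rewrite tail_rec => Dm; have [s sE] : exists s, ser (tail m) = tvar ^+ m.+1 * s.
    apply: vanish_tvarP => c; rewrite /= /tail; case: (mdeg c) => // d.
    by rewrite ltnS => ->.
  have s0 : mfcoef s 0%MM = a m.
    by rewrite -(mfcoef_tvarXM m.+1) -sE /= mdeg_tn /tail ltnn.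
  rewrite -tail_rec sE exprMn -exprM in Dm; have {}Dm := DtdX Dm.
  have ra : res (a m ^+ q m).
    exists (s ^+ q m); split=> //; rewrite -s0.
    elim: (q m) => [|j ih]; last by rewrite !exprS mfcoefM0 ih.
    by rewrite !expr0 -[1]/(mfpsC 1 1) mfcoefC eqxx.
  have um : u ^+ (M m * q m) != 0 by rewrite expf_neq0.
  rewrite -[b m](mulfK um) -a_q; apply: resM => //.
  by apply/resV/res_const; rewrite rmorphXn; apply: DX.
suff Dn : D (ser (tail n) ^+ q n) by split=> //; apply: step.
elim: n => [|n ih]; first by rewrite /q big_ord0 expr1.
have rb := step n ih; have [Q [Q0 Q1]] := b_sep n.
have [f [Df fb]] : res (b n ^+ r n).
  elim: (r n) => [|j rj]; last by rewrite exprS; apply: resM.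
  by apply: res_const; rewrite expr0 rmorph1.
have Db : D (mfpsC 1 (b n ^+ r n)).
  apply: newton_const Df fb _ Q0 Q1 => i; rewrite coef_map; apply: Devu.
have qS : q n.+1 = (q n * r n)%N by rewrite /q big_ord_recr.
(* Raising to the power [q n.+1] is additive, this exponent being a power of the characteristic
   exponent. *)
have -> : ser (tail n.+1) ^+ q n.+1 =
    ser (tail n) ^+ q n.+1 - (mfpsC 1 (a n) * tvar ^+ n.+1) ^+ q n.+1.
  by rewrite (tail_rec n) exprDn_pchar // addrAC subrr add0r.
apply: DB; first by rewrite qS exprM; apply: DX.
rewrite exprMn; apply: DM; last by do 2!apply: DX.
rewrite -rmorphXn qS exprM a_q exprMn rmorphM; apply: DM => //.
by rewrite !rmorphXn; do 2!apply: DX.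
Qed.

End Generators.
End Residues.

(** * The valuation induced by an embedding into L[[t]] *)

Lemma fraction_ex (R : idomainType) (x : {fraction R}) :
  exists q : R * R, q.2 != 0 /\ x = tofrac q.1 / tofrac q.2.
Proof.
elim/quotW: x => x; exists (\n_x, \d_x); split=> /=; first exact: denom_ratioP.
have d0 : tofrac \d_x != 0 by rewrite tofrac_eq0 denom_ratioP.
apply: (mulIf d0); rewrite divfK //; unlock tofrac.
rewrite -[LHS]FracField.pi_mul; apply/eqmodP; rewrite /= FracField.equivfE.
rewrite /FracField.mulf !numden_Ratio ?mulf_neq0 ?oner_neq0 ?denom_ratioP //.
by apply/eqP; ring.
Qed.

Section Ord.
Variable L : fieldType.
Implicit Types f h : {mfps L[1]}.

(** For the zero series the set is empty and the value is the default 0. *)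
Definition tord f : nat :=
  xget 0%N [set e | exists h, f = tvar ^+ e * h /\ mfcoef h 0%MM != 0]%classic.

Lemma tord_eq f e h : f = tvar ^+ e * h -> mfcoef h 0%MM != 0 -> tord f = e.
Proof.
move=> fE h0; have tX n : (tvar : {mfps L[1]}) ^+ n != 0 by rewrite expf_neq0 ?mfX_neq0.
have low a b (s s' : {mfps L[1]}) : mfcoef s 0%MM != 0 ->
    tvar ^+ a * s = tvar ^+ b * s' -> (b <= a)%N.
  move=> s0 E; rewrite leqNgt; apply/negP => ab; case/negP: s0; apply/eqP.
  move: E; rewrite -(subnKC (ltnW ab)) exprD -mulrA => /(mulfI (tX a)) ->.
  by apply: vanish_tvarX; rewrite mdeg0 subn_gt0.
rewrite /tord; case: xgetP => [e' _ [h' [fE' h'0]]|/(_ e)[]]; last by exists h.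
by apply/eqP; rewrite eqn_leq (low _ _ h h') -?fE // (low _ _ h' h) -?fE'.
Qed.

Lemma tord_ex f : f != 0 -> exists h, f = tvar ^+ tord f * h /\ mfcoef h 0%MM != 0.
Proof.
move=> /mfps1_ord[e [h [fE h0]]]; exists h; split=> //.
by rewrite (tord_eq fE h0).
Qed.

Lemma tordM f h : f != 0 -> h != 0 -> tord (f * h) = (tord f + tord h)%N.
Proof.
move=> /tord_ex[f' [fE f0]] /tord_ex[h' [hE h0]].
apply: (@tord_eq _ _ (f' * h')); last by rewrite mfcoefM0 mulf_neq0.
by rewrite {1}fE {1}hE exprD mulrACA.
Qed.

Lemma vanish_tord f n : f != 0 -> vanish n f <-> (n <= tord f)%N.
Proof.
move=> f0; have [h [fE h0]] := tord_ex f0; split=> [fv|nf].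
  rewrite leqNgt; apply/negP => fn; case/negP: h0; apply/eqP.
  by rewrite -(mfcoef_tvarXM (tord f)) -fE; apply: fv; rewrite mdeg_tn.
by have := @vanish_tvarX L (tord f) h; rewrite -fE; apply: vanishW.
Qed.

Lemma tordD f h : f != 0 -> h != 0 -> f + h != 0 ->
  (minn (tord f) (tord h) <= tord (f + h)%R)%N.
Proof.
move=> f0 h0 fh0; apply/vanish_tord => //; apply: vanishD.
  by apply/vanish_tord => //; rewrite geq_minl.
by apply/vanish_tord => //; rewrite geq_minr.
Qed.

Lemma tord_gt0 f : f != 0 -> (0 < tord f)%N = (mfcoef f 0%MM == 0).
Proof.
move=> f0; apply/idP/eqP => [/(vanish_tord _ f0)/vanish1P//|/vanish1P fv].
exact/vanish_tord.
Qed.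

End Ord.

(** * The t-adic valuation on the quotient field and its residue map *)

Section Valuation.
Variables (k L : fieldType) (g : {rmorphism k -> L}).
Local Notation A := {mfps k[3]}.
Local Notation P := {mfps L[1]}.
Local Notation K := {fraction A}.
Variable Phi : {rmorphism A -> P}.
Hypothesis Phi_inj : forall F, Phi F = 0 -> F = 0.
Hypothesis Phi0 : forall F, mfcoef (Phi F) 0%MM = g (mfcoef F 0%MM).
Hypothesis PhiX : exists X, Phi X = tvar.
Hypothesis PhiC : forall c, Phi (mfpsC 3 c) = mfpsC 1 (g c).

Let num (x : K) : A := (projT1 (cid (fraction_ex x))).1.
Let den (x : K) : A := (projT1 (cid (fraction_ex x))).2.

Let den0 x : den x != 0.
Proof. by rewrite /den; case: (cid _) => q []. Qed.
Let nd x : x = tofrac (num x) / tofrac (den x).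
Proof. by rewrite /num /den; case: (cid _) => q []. Qed.

Let Phi_neq0 F : F != 0 -> Phi F != 0.
Proof. by apply: contra_neq => /Phi_inj. Qed.

Let cross (F G F' G' : A) : G != 0 -> G' != 0 ->
  tofrac F / tofrac G = tofrac F' / tofrac G' -> F * G' = F' * G.
Proof.
move=> G0 G0' /eqP; rewrite eqr_div ?tofrac_eq0 // -!tofracM tofrac_eq.
by move/eqP.
Qed.

(** Computed from a chosen fraction; [val_funE] shows, by cross-multiplication, that the choice does
    not matter for nonzero elements. *)
Definition val_fun (x : K) : int := (tord (Phi (num x)))%:Z - (tord (Phi (den x)))%:Z.

Lemma val_funE F G : F != 0 -> G != 0 ->
  val_fun (tofrac F / tofrac G) = (tord (Phi F))%:Z - (tord (Phi G))%:Z.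
Proof.
move=> F0 G0; rewrite /val_fun; set x := _ / _.
have /cross := nd x => /(_ G0 (den0 x)) E.
have n0 : num x != 0.
  apply: contra_neq (mulf_neq0 F0 (den0 x)) => n0; by rewrite E n0 mul0r.
have := congr1 (fun f => tord (Phi f)) E; rewrite !rmorphM.
rewrite !tordM ?Phi_neq0 // => {}E.
by apply/eqP; rewrite subr_eq addrAC eq_sym subr_eq -!PoszD E.
Qed.

Let num0 x : x != 0 -> num x != 0.
Proof. by apply: contra_neq => n0; rewrite (nd x) n0 tofrac0 mul0r. Qed.

Lemma val_funM x y : x != 0 -> y != 0 -> val_fun (x * y) = val_fun x + val_fun y.
Proof.
move=> x0 y0; have [dx dy] := (den0 x, den0 y).
have vxy := val_funE (mulf_neq0 (num0 x0) (num0 y0)) (mulf_neq0 dx dy).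
rewrite !tofracM -mulf_div -!nd in vxy; rewrite vxy !rmorphM /val_fun.
by rewrite !tordM ?Phi_neq0 ?num0 // !PoszD opprD addrACA.
Qed.

Lemma val_funD x y : x != 0 -> y != 0 -> x + y != 0 ->
  Num.min (val_fun x) (val_fun y) <= val_fun (x + y).
Proof.
move=> x0 y0 xy0; have [dx dy] := (den0 x, den0 y).
have Ex : x = tofrac (num x * den y) / tofrac (den x * den y).
  by rewrite !tofracM -mulf_div divff ?tofrac_eq0 // mulr1 -nd.
have Ey : y = tofrac (num y * den x) / tofrac (den x * den y).
  by rewrite [den x * _]mulrC !tofracM -mulf_div divff ?tofrac_eq0 // mulr1 -nd.
have Exy : x + y = tofrac (num x * den y + num y * den x) / tofrac (den x * den y).
  by rewrite tofracD mulrDl -Ex -Ey.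
have s0 : num x * den y + num y * den x != 0.
  by apply: contra_neq xy0; rewrite Exy => ->; rewrite tofrac0 mul0r.
have dxy : den x * den y != 0 by rewrite mulf_neq0.
have vx := val_funE (mulf_neq0 (num0 x0) dy) dxy.
have vy := val_funE (mulf_neq0 (num0 y0) dx) dxy.
have vxy := val_funE s0 dxy.
rewrite -Ex in vx; rewrite -Ey in vy; rewrite -Exy in vxy.
rewrite vx vy vxy -addr_minl lerD2r.
rewrite ge_min !lez_nat -geq_min rmorphD.
by apply: tordD; rewrite -?rmorphD ?Phi_neq0 ?mulf_neq0 ?num0.
Qed.

Lemma val_fun_surj z : exists2 x, x != 0 & val_fun x = z.
Proof.
have [X PX] := PhiX; have X0 : X != 0.
  apply/eqP => X0; have := mfX_neq0 L (ord0 : 'I_1); rewrite -[mfX _]/tvar -PX X0.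
  by rewrite rmorph0 eqxx.
have oX n : tord (Phi (X ^+ n)) = n.
  rewrite rmorphXn PX; apply: (@tord_eq _ _ _ 1); first by rewrite mulr1.
  by rewrite -[1]/(mfpsC 1 1) mfcoefC eqxx oner_eq0.
case: z => n; [exists (tofrac (X ^+ n) / tofrac (X ^+ 0))|
    exists (tofrac (X ^+ 0) / tofrac (X ^+ n.+1))].
- by rewrite mulf_neq0 ?invr_eq0 ?tofrac_eq0 ?expf_neq0.
- by rewrite val_funE ?expf_neq0 // !oX subr0.
- by rewrite mulf_neq0 ?invr_eq0 ?tofrac_eq0 ?expf_neq0.
by rewrite val_funE ?expf_neq0 // !oX sub0r NegzE.
Qed.

Lemma val_tofrac F : F != 0 -> val_fun (tofrac F) = tord (Phi F).
Proof.
move=> F0; rewrite -[tofrac F]divr1 -tofrac1 val_funE ?oner_eq0 // rmorph1.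
rewrite (@tord_eq _ 1 0 1) ?subr0 ?mulr1 //.
by rewrite -[1]/(mfpsC 1 1) mfcoefC eqxx oner_eq0.
Qed.

Lemma val_fun_triv c : c != 0 -> val_fun (mfracC 3 k c) = 0.
Proof.
move=> c0; rewrite -[mfracC 3 k c]/(tofrac (mfpsC 3 c)) val_tofrac.
  rewrite PhiC (@tord_eq _ _ 0 (mfpsC 1 (g c))) ?mul1r //.
  by rewrite mfcoefC eqxx fmorph_eq0.
apply: contra_neq c0 => /(congr1 (fun f : A => mfcoef f 0%MM)).
by rewrite mfcoef0 mfcoefC eqxx.
Qed.

Definition embedding_valuation : discreteValuation (mfracC 3 k) :=
  DiscreteValuation val_funM val_funD val_fun_surj val_fun_triv.
Local Notation v := embedding_valuation.

Lemma tofrac_vring F : tofrac F \in vring_pred v.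
Proof.
rewrite unfold_in; have [->|F0] := eqVneq F 0; first by rewrite tofrac0 eqxx.
by rewrite /= val_tofrac // lez_nat leq0n orbT.
Qed.

Lemma center_maxideal : center v =i mfps_maxideal.
Proof.
move=> F; rewrite !unfold_in tofrac_eq0.
have [->|F0] := eqVneq F 0; first by rewrite mfcoef0 eqxx.
by rewrite /= val_tofrac // ltz_nat tord_gt0 ?Phi_neq0 // Phi0 fmorph_eq0.
Qed.

(** For a fraction of nonnegative value the image of the numerator has order at least that of the
    denominator, so the quotient is again a power series. This extends [Phi] to the valuation
    ring. *)
Let lam_ex (x : vring v) : exists f, f * Phi (den (val x)) = Phi (num (val x)).
Proof.
have [x0|x0] := eqVneq (val x) 0.
  exists 0; rewrite mul0r; suff -> : num (val x) = 0 by rewrite rmorph0.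
  apply/eqP; move/eqP: x0; rewrite {1}(nd (val x)) mulf_eq0 invr_eq0 !tofrac_eq0.
  by rewrite (negPf (den0 _)) orbF.
have := valP x; rewrite unfold_in (negPf x0) /= /val_fun subr_ge0 lez_nat => le.
have [h [dE h0]] := tord_ex (Phi_neq0 (den0 (val x))).
have [f [nE _]] := tord_ex (Phi_neq0 (num0 x0)).
exists (tvar ^+ (tord (Phi (num (val x))) - tord (Phi (den (val x)))) * f / h).
rewrite {2}dE [tvar ^+ _ * h]mulrC mulrA divrK ?mfps_unitE // mulrAC -exprD.
by rewrite subnK // -nE.
Qed.

Definition lift_vring (x : vring v) : P := projT1 (cid (lam_ex x)).

Lemma lift_vringE (x : vring v) F G : G != 0 -> val x = tofrac F / tofrac G ->
  lift_vring x * Phi G = Phi F.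
Proof.
move=> G0 xE; rewrite /lift_vring; case: (cid _) => f /= fE.
have /cross : tofrac F / tofrac G = tofrac (num (val x)) / tofrac (den (val x)).
  by rewrite -nd.
move=> /(_ G0 (den0 _)) E; apply: (mulIf (Phi_neq0 (den0 (val x)))).
by rewrite mulrAC fE -!rmorphM E.
Qed.

Let vring_nd (x : vring v) : val x = tofrac (num (val x)) / tofrac (den (val x)).
Proof. exact: nd. Qed.

Lemma lift_vring_is_zmod_morphism : zmod_morphism lift_vring.
Proof.
move=> x y; have [dx dy] := (den0 (val x), den0 (val y)).
have xy : val (x - y) = tofrac (num (val x) * den (val y) - num (val y) * den (val x))
    / tofrac (den (val x) * den (val y)).
  rewrite rmorphB /= {1}(vring_nd x) {1}(vring_nd y) tofracB !tofracM.
  by rewrite -mulNr addf_div ?tofrac_eq0 // mulNr.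
have dxy : den (val x) * den (val y) != 0 by rewrite mulf_neq0.
apply: (mulIf (Phi_neq0 dxy)); rewrite (lift_vringE dxy xy) rmorphB !rmorphM.
by rewrite -(lift_vringE dx (vring_nd x)) -(lift_vringE dy (vring_nd y)); ring.
Qed.

Lemma lift_vring_is_monoid_morphism : monoid_morphism lift_vring.
Proof.
split=> [|x y].
  have E : val (1 : vring v) = tofrac 1 / tofrac 1 by rewrite tofrac1 divr1 rmorph1.
  by have := lift_vringE (oner_neq0 _) E; rewrite !(rmorph1 Phi) mulr1.
have [dx dy] := (den0 (val x), den0 (val y)).
have xy : val (x * y) = tofrac (num (val x) * num (val y))
    / tofrac (den (val x) * den (val y)).
  by rewrite rmorphM /= {1}(vring_nd x) {1}(vring_nd y) !tofracM mulf_div.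
have dxy : den (val x) * den (val y) != 0 by rewrite mulf_neq0.
apply: (mulIf (Phi_neq0 dxy)); rewrite (lift_vringE dxy xy) !rmorphM.
by rewrite -(lift_vringE dx (vring_nd x)) -(lift_vringE dy (vring_nd y)); ring.
Qed.

Definition lift_vring_coef0 (x : vring v) : L := mfcoef (lift_vring x) 0%MM.

Lemma lift_vring_coef0_is_zmod_morphism : zmod_morphism lift_vring_coef0.
Proof.
by move=> x y; rewrite /lift_vring_coef0 lift_vring_is_zmod_morphism mfcoefB.
Qed.

Lemma lift_vring_coef0_is_monoid_morphism : monoid_morphism lift_vring_coef0.
Proof.
have [h1 hM] := lift_vring_is_monoid_morphism; split=> [|x y].
  by rewrite /lift_vring_coef0 h1 -[1]/(mfpsC 1 1) mfcoefC eqxx.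
by rewrite /lift_vring_coef0 hM mfcoefM0.
Qed.

Definition vring_residue : {rmorphism vring v -> L} :=
  HB.pack_for {rmorphism vring v -> L} lift_vring_coef0
    (GRing.isZmodMorphism.Build (vring v) L lift_vring_coef0
      lift_vring_coef0_is_zmod_morphism)
    (GRing.isMonoidMorphism.Build (vring v) L lift_vring_coef0
      lift_vring_coef0_is_monoid_morphism).

(** The value of a nonzero x is the order of its lift, which is positive exactly when the constant
    term vanishes. *)
Lemma vring_residue_eq0 x : (vring_residue x == 0) = (x \in @vmax _ _ _ v).
Proof.
rewrite vmaxE -[vring_residue x]/(mfcoef (lift_vring x) 0%MM).
have dx := den0 (val x); have xE := lift_vringE dx (vring_nd x).
have [x0|x0] := eqVneq (val x) 0.
  have : lift_vring x = 0.
    apply: (mulIf (Phi_neq0 dx)); rewrite xE mul0r.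
    have : num (val x) = 0; last by move=> ->; rewrite rmorph0.
    apply/eqP; move/eqP: x0; rewrite {1}(vring_nd x) mulf_eq0 invr_eq0 !tofrac_eq0.
    by rewrite (negPf dx) orbF.
  by move=> ->; rewrite mfcoef0 eqxx.
have f0 : lift_vring x != 0.
  apply: contra_neq (Phi_neq0 (num0 x0)) => f0; by rewrite -xE f0 mul0r.
rewrite -(tord_gt0 f0) /= /val_fun -xE tordM ?Phi_neq0 // PoszD addrK.
by rewrite ltz_nat.
Qed.

Lemma vring_residueC c : vring_residue (VRing (vring_const v c)) = g c.
Proof.
rewrite -[LHS]/(mfcoef (lift_vring _) 0%MM).
have E : val (VRing (vring_const v c)) = tofrac (mfpsC 3 c) / tofrac 1.
  by rewrite tofrac1 divr1.
have := lift_vringE (oner_neq0 _) E; rewrite (rmorph1 Phi) mulr1 => ->.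
by rewrite Phi0 mfcoefC eqxx.
Qed.

Lemma vring_residue_surj F G f : G != 0 -> f * Phi G = Phi F ->
  exists x, vring_residue x = mfcoef f 0%MM.
Proof.
move=> G0 fE; have xv : tofrac F / tofrac G \in vring_pred v.
  rewrite unfold_in; have [->|F0] := eqVneq F 0; first by rewrite tofrac0 mul0r eqxx.
  have f0 : f != 0 by apply: contra_neq (Phi_neq0 F0) => f0; rewrite -fE f0 mul0r.
  by rewrite /= val_funE // -fE tordM ?Phi_neq0 // PoszD addrK lez_nat leq0n orbT.
exists (VRing xv); rewrite -[LHS]/(mfcoef (lift_vring _) 0%MM); congr mfcoef.
by apply: (mulIf (Phi_neq0 G0)); rewrite fE; apply: lift_vringE.
Qed.

End Valuation.

(** The first isomorphism theorem for a surjection whose kernel is the maximal ideal. *)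
Lemma residue_iso (k K L : fieldType) (j : {rmorphism k -> K})
    (v : discreteValuation j) (lam : {rmorphism vring v -> L}) :
    (forall x, (lam x == 0) = (x \in @vmax _ _ _ v)) -> (forall b, exists x, lam x = b) ->
  exists2 phi : {rmorphism residueField v -> L}, bijective phi &
    forall x, phi (residue x) = lam x.
Proof.
move=> ker surj; pose f (a : residueField v) : L := lam (repr a).
have fE x : f (residue x) = lam x.
  have e : residue (repr (residue x)) = residue x by rewrite /residue reprK.
  apply/eqP; rewrite -subr_eq0 -rmorphB ker -[_ \in _]residue_eq0.
  by apply/eqP/(etrans (rmorphB _ _ _)); apply/eqP; rewrite subr_eq0; apply/eqP.
have rE (a : residueField v) : exists x, a = residue x.
  by exists (repr a); rewrite /residue reprK.
pose rm : {rmorphism vring v -> residueField v} :=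
  GRing.RMorphism.clone _ _ (@residue _ _ _ v) _.
have fB : zmod_morphism f.
  move=> a b; have [[x ->] [y ->]] := (rE a, rE b).
  by rewrite -[residue x]/(rm x) -[residue y]/(rm y) -rmorphB !fE rmorphB.
have fM : monoid_morphism f.
  split=> [|a b]; first by rewrite -(rmorph1 rm) fE rmorph1.
  have [[x ->] [y ->]] := (rE a, rE b).
  by rewrite -[residue x]/(rm x) -[residue y]/(rm y) -rmorphM !fE rmorphM.
pose phi : {rmorphism residueField v -> L} :=
  HB.pack_for {rmorphism residueField v -> L} f
    (GRing.isZmodMorphism.Build (residueField v) L f fB)
    (GRing.isMonoidMorphism.Build (residueField v) L f fM).
exists phi => //; have [h hE] := choice surj.
exists (fun b => residue (h b)) => [a|b]; last by rewrite -[LHS]/(f _) fE hE.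
apply: (fmorph_inj phi); rewrite -[LHS]/(f _) -[RHS]/(f _) fE hE; reflexivity.
Qed.

(** * The t-adic closure in L[[t]] *)

Section Closure.
Variables (L : fieldType) (K : {mfps L[1]} -> Prop).

Definition adic_closure f := forall N, exists h, K h /\ vanish N (h - f).
Local Notation D := adic_closure.

Lemma sub_adic_closure f : K f -> D f.
Proof. by move=> kf N; exists f; rewrite subrr; split=> //; apply: vanish0. Qed.

Lemma adic_closureK f : (forall N, exists h, D h /\ vanish N (h - f)) -> D f.
Proof.
move=> df N; have [h [/(_ N)[s [ks sh]] hf]] := df N; exists s; split=> //.
by rewrite -[s](subrK h) -addrA; apply: vanishD.
Qed.

Lemma adic_closureB f h : (forall f h, K f -> K h -> K (f - h)) ->
  D f -> D h -> D (f - h).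
Proof.
move=> KB df dh N; have [s [ks sf]] := df N; have [t [kt th]] := dh N.
exists (s - t); split; first exact: KB.
by rewrite opprD addrACA -opprD; apply: vanishB.
Qed.

Lemma adic_closureM f h : (forall f h, K f -> K h -> K (f * h)) ->
  D f -> D h -> D (f * h).
Proof.
move=> KM df dh N; have [s [ks sf]] := df N; have [t [kt th]] := dh N.
by exists (s * t); split; [apply: KM|apply: vanish_congM].
Qed.

Lemma adic_closureV f : (forall f, K f -> mfcoef f 0%MM != 0 -> K f^-1) ->
  D f -> mfcoef f 0%MM != 0 -> D f^-1.
Proof.
(* Precision N + 1 makes the constant terms agree even when N = 0, so that s is a unit. *)
move=> KV df f0 N; have [s [ks sf]] := df N.+1.
have s0 : mfcoef s 0%MM = mfcoef f 0%MM.
  by apply/eqP; rewrite -subr_eq0 -mfcoefB; apply/eqP/sf; rewrite mdeg0.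
exists s^-1; rewrite -s0 in f0; split; first exact: KV.
have us : s \is a GRing.unit by rewrite mfps_unitE.
have uf : f \is a GRing.unit by rewrite mfps_unitE -s0.
have -> : s^-1 - f^-1 = - (s^-1 * f^-1 * (s - f)).
  by rewrite mulrBr mulrAC mulVr // mul1r -mulrA mulVr // mulr1 opprB.
by apply/vanishN/vanishMl; apply: vanishW (leqnSn N) sf.
Qed.

Lemma adic_closure_td f : (forall f, K (tvar * f) -> K f) -> D (tvar * f) -> D f.
Proof.
move=> Ktd df N; have [s [ks /vanish_tvarP[h hE]]] := df N.+1.
(* The approximation s of t f equals t f + t^(N+1) h, and this witness is s divided by t. *)
exists (f + tvar ^+ N * h); split; last by rewrite addrC addKr; apply: vanish_tvarX.
by apply: Ktd; rewrite mulrDr mulrA -exprS -hE addrC subrK.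
Qed.

End Closure.

(** * Realizing L from separable powers of its generators *)

Section Realization.
Variables (k L : fieldType) (g : {rmorphism k -> L}) (u : L).
Hypothesis u_tr : forall p : {poly k}, (map_poly g p).[u] = 0 -> p = 0.
Variables (b beta : nat -> L) (r : nat -> nat).
Hypotheses (r_pchar : forall n, [pchar L].-nat (r n)) (b0 : forall n, b n != 0).
Hypothesis betaE : forall n, beta n ^+ (\prod_(i < n) r i)%N = b n.
Hypothesis b_sep : forall n, exists Q : {poly {poly k}},
  (map_poly (evu g u) Q).[b n ^+ r n] = 0 /\
  (map_poly (evu g u) Q)^`().[b n ^+ r n] != 0.
Hypothesis gen : forall S : set L, divring_closed (mem S) ->
  (forall c, S (g c)) -> S u -> (forall n, S (b n)) -> S = setT.

(** The residues of the closure [D] form a subfield containing k, u and all b_n, hence are all of L,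
    and each of them is already a residue of the quotient field. *)
Lemma realization : exists v : discreteValuation (mfracC 3 k),
  [/\ forall f : {mfps k[3]}, tofrac f \in vring_pred v,
      center v =i mfps_maxideal
    & exists2 phi : {rmorphism residueField v -> L},
        bijective phi & forall c : k, phi (residueC v c) = g c].
Proof.
have u0 : u != 0.
  apply/eqP => u0; have /eqP : 'X = 0 :> {poly k}.
    by apply: u_tr; rewrite map_polyX hornerX.
  by rewrite polyX_eq0.
have beta0 n : beta n != 0.
  apply: contra_neq (b0 n) => bn; rewrite -betaE bn expr0n.
  suff : (0 < \prod_(i < n) r i)%N by case: (\prod_(i < n) r i)%N.
  by apply: prodn_gt0 => i; case/andP: (r_pchar i).
have [M] := independent_series u_tr beta0; set a := fun n => _ => PhiI.
pose F := Phi g u (ser0 a); have Phi_inj f : F f = 0 -> f = 0 by apply: PhiI.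
have PhiX0 : F (mfX (inord 0)) = tvar.
  by rewrite /F /Phi substX /sub3 /= inordK.
have PhiX1 : F (mfX (inord 1)) = mfpsC 1 u * tvar.
  by rewrite /F /Phi substX /sub3 /= inordK.
have PhiX2 : F (mfX (inord 2)) = ser a.
  by rewrite /F /Phi substX /sub3 /= inordK.
have Phi0 f : mfcoef (F f) 0%MM = g (mfcoef f 0%MM) by apply: subst_coef0.
have PhiC c : F (mfpsC 3 c) = mfpsC 1 (g c) by apply: substC.
have PhiX : exists X, F X = tvar by exists (mfX (inord 0)).
clearbody F.
pose v := embedding_valuation Phi_inj PhiX PhiC.
exists v; split; [exact: tofrac_vring|exact: center_maxideal|].
(* The power series that lie in the image of the quotient field. *)
pose K f := exists A B, B != 0 /\ f * F B = F A.
have K1 : K 1 by exists 1, 1; rewrite oner_eq0 rmorph1 mulr1.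
have KB f h : K f -> K h -> K (f - h).
  move=> [A [B [B0 fE]]] [A' [B' [B0' hE]]]; exists (A * B' - A' * B), (B * B').
  rewrite mulf_neq0 // rmorphB !rmorphM -fE -hE; split=> //; ring.
have KM f h : K f -> K h -> K (f * h).
  move=> [A [B [B0 fE]]] [A' [B' [B0' hE]]]; exists (A * A'), (B * B').
  by rewrite mulf_neq0 // !rmorphM -fE -hE mulrACA.
have KV f : K f -> mfcoef f 0%MM != 0 -> K f^-1.
  move=> [A [B [B0 fE]]] f0; exists B, A; have uf : f \is a GRing.unit.
    by rewrite mfps_unitE.
  split; last by rewrite -fE mulKr.
  apply/eqP => A0; move: fE; rewrite A0 rmorph0 => /(canRL (mulKr uf)).
  by rewrite mulr0 => /Phi_inj B1; rewrite B1 eqxx in B0.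
have Kim A : K (F A) by exists A, 1; rewrite oner_eq0 rmorph1 mulr1.
have Ktd f : K (tvar * f) -> K f.
  move=> [A [B [B0 fE]]]; exists A, (mfX (inord 0) * B).
  by rewrite mulf_neq0 ?mfX_neq0 // rmorphM PhiX0 mulrA [f * _]mulrC.
have Kt : K tvar by rewrite -PhiX0.
have Kk c : K (mfpsC 1 (g c)) by rewrite -PhiC.
(* The constant u is the image of X_2 / X_1. *)
have Ku : K (mfpsC 1 u).
  by exists (mfX (inord 1)), (mfX (inord 0)); rewrite mfX_neq0 PhiX0 PhiX1.
have Kx : K (ser a) by rewrite -PhiX2.
pose D := adic_closure K.
have KD f : K f -> D f by apply: sub_adic_closure.
have DB f h : D f -> D h -> D (f - h) by apply: adic_closureB.
have DM f h : D f -> D h -> D (f * h) by apply: adic_closureM.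
have DV f : D f -> mfcoef f 0%MM != 0 -> D f^-1 by apply: adic_closureV.
have resb := res_gen (KD _ K1) DB DM DV (KD _ Kt) (fun f => @adic_closure_td _ _ f Ktd)
  (@adic_closureK _ K) (fun c => KD _ (Kk c)) (KD _ Ku) r_pchar u0 betaE b_sep
  (KD _ Kx).
have resC c : D (mfpsC 1 c) -> res D c.
  by move=> Dc; exists (mfpsC 1 c); rewrite mfcoefC eqxx.
have resT : [set c | res D c]%classic = setT.
  apply: gen => //= [|c|]; try by apply: resC; apply: KD.
  split=> [|x y|x y]; rewrite !inE.
  - by apply: resC; rewrite rmorph1; apply: KD.
  - exact: resB.
  by move=> rx ry; apply: (resM DM rx); apply: resV ry => //; apply: KD.
have [|c|phi bphi phiE] := @residue_iso _ _ L _ v (vring_residue Phi_inj PhiX PhiC).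
- exact: vring_residue_eq0.
(* Approximation modulo t already fixes the constant term. *)
- have [f [/(_ 1%N)[h [[A [B [B0 hE]]] hf]] fc]] : res D c.
    by rewrite -[res D c]/([set c | res D c]%classic c) resT.
  have [x xE] := vring_residue_surj Phi_inj PhiX PhiC B0 hE.
  exists x; rewrite xE -fc; apply/eqP; rewrite -subr_eq0 -mfcoefB.
  by apply/eqP/vanish1P.
by exists phi => // c; rewrite /residueC phiE vring_residueC.
Qed.

End Realization.

(** * Separability over k(w) *)

Lemma coef_XsubC_expn (R : comNzRingType) (c : R) d :
  (('X - c%:P) ^+ d.+1)`_d = - c *+ d.+1.
Proof.
elim: d => [|d ih]; first by rewrite expr1 coefB coefX coefC sub0r.
rewrite exprS mulrBl coefB coefXM /= ih coefCM.
have -> : (('X - c%:P) ^+ d.+1)`_d.+1 = 1.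
  rewrite -[X in _`_X]/(d.+2.-1) -[d.+2](size_exp_XsubC d.+1 c) -/(lead_coef _).
  by apply/monicP/monic_exp/monicXsubC.
by rewrite mulr1 [RHS]mulrSr.
Qed.

(* The only monic divisors of X^p - w^p = (X - w)^p are powers of X - w. *)
Lemma pow_free (L : fieldType) p (pcharLp : p \in [pchar L]) (w : L) (z : nat -> L) :
  (forall y, y ^+ p != w) -> \sum_(i < p) w ^+ i * z i ^+ p = 0 ->
  forall i, (i < p)%N -> z i = 0.
Proof.
move=> nw zw; have p_pr := pcharf_prime pcharLp.
pose phi : {rmorphism L -> L} := GRing.RMorphism.clone _ _ (pFrobenius_aut pcharLp) _; pose Rz : {poly L} := \poly_(i < p) z i.
have Rzw : (map_poly phi Rz).[w] = 0.
  rewrite (@horner_coef_wide _ p) ?size_map_poly ?size_poly // -[RHS]zw.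
  apply: eq_bigr => i _; rewrite coef_map coef_poly ltn_ord mulrC.
  by rewrite /phi /= pFrobenius_autE.
(* With [phi] the Frobenius map, the twist of X^p - w is (X - w)^p. If the twist of R vanishes at w,
   so does that of the remainder of X^p - w by R; by induction this remainder is zero and R divides
   X^p - w. *)
suff noroot n (R : {poly L}) : (size R <= n)%N -> (size R <= p)%N ->
    (map_poly phi R).[w] = 0 -> R = 0.
  have R0 : Rz = 0 by apply: (noroot p) => //; apply: size_poly.
  by move=> i ip; have := congr1 (fun q : {poly L} => q`_i) R0; rewrite coef_poly ip coef0.
elim: n R => [|n ih] R; first by rewrite size_poly_leq0 => /eqP.
move=> Rn Rp Rw; apply/eqP; apply: contraT => R0; exfalso.
pose S : {poly L} := 'X^p - w%:P.
have pLX : p \in [pchar {poly L}] by rewrite pchar_poly.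
have phiS : map_poly phi S = ('X - w%:P) ^+ p.
  rewrite /S rmorphB /= map_polyXn map_polyC /= /phi pFrobenius_autE.
  rewrite -[RHS](pFrobenius_autE pLX) pFrobenius_autB_comm; last exact: mulrC.
  by rewrite !pFrobenius_autE rmorphXn.
have phi_inj : injective (map_poly phi) by apply: map_inj_poly; [apply: fmorph_inj|exact: rmorph0].
have SR : R %| S.
  rewrite /dvdp; apply/eqP/ih.
  - by rewrite -ltnS (leq_trans _ Rn) // ltn_modp.
  - by rewrite (leq_trans _ Rp) // ltnW // ltn_modp.
  have := congr1 (fun q => (map_poly phi q).[w]) (divp_eq S R).
  rewrite phiS rmorphD rmorphM /= hornerD hornerM Rw mulr0 add0r => <-.
  by rewrite horner_exp hornerXsubC subrr expr0n eqn0Ngt prime_gt0.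
have : map_poly phi R %| ('X - w%:P) ^+ p by rewrite -phiS dvdp_map.
case/dvdp_exp_XsubCP => d dp /eqpP[[a b] /andP[/= a0 b0] abE].
have sR : size R = d.+1.
  have := congr1 (fun q : {poly L} => size q) abE.
  by rewrite !size_scale // size_map_poly size_exp_XsubC.
case: d dp abE sR => [|d] dp abE sR.
  have := congr1 (fun q : {poly L} => q.[w]) abE.
  rewrite expr0 !hornerZ Rw mulr0 hornerC mulr1 => /esym/eqP.
  by rewrite (negPf b0).
have d1 : (d.+1)%:R != 0 :> L.
  by rewrite -(dvdn_pcharf pcharLp) gtnNdvd // (leq_trans _ Rp) // sR.
have lR : a * phi R`_d.+1 = b.
  have := congr1 (fun q : {poly L} => q`_d.+1) abE.
  rewrite !coefZ coef_map /= => ->.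
  rewrite -[X in _`_X]/(d.+2.-1) -[d.+2](size_exp_XsubC d.+1 w) -/(lead_coef _).
  by rewrite (monicP _) ?mulr1 // monic_exp // monicXsubC.
have eR : a * phi R`_d = b * (- w *+ d.+1).
  have := congr1 (fun q : {poly L} => q`_d) abE.
  by rewrite !coefZ coef_map coef_XsubC_expn.
have l0 : R`_d.+1 != 0.
  by apply: contra_neq b0 => e; rewrite -lR e rmorph0 mulr0.
(* The twist of R is proportional to (X - w)^(d+1), so the ratio of its two top coefficients is -
   (d+1) w. As d + 1 is invertible, w is a p-th power. *)
have /eqP[] := nw (- (R`_d / (R`_d.+1 * d.+1%:R))).
rewrite -(pFrobenius_autE pcharLp) -[LHS]/(phi _) rmorphN fmorph_div rmorphM rmorph_nat.
have -> : phi R`_d = - (w * (phi R`_d.+1 * d.+1%:R)).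
  by apply: (mulfI a0); rewrite eR -lR -mulr_natr; ring.
by rewrite mulNr opprK mulfK // mulf_neq0 // fmorph_eq0.
Qed.

(** * Polynomials over a closed field of characteristic p *)

Section Perfect.
Variables (k : closedFieldType) (p : nat) (pchark : p \in [pchar k]).

Lemma closed_proot (c : k) : exists d, d ^+ p = c.
Proof.
have p0 : (0 < p)%N := prime_gt0 (pcharf_prime pchark).
have /closed_rootP[d] : size ('X^p - c%:P : {poly k}) != 1%N.
  by rewrite size_XnsubC // eqSS -lt0n.
by move/rootP/eqP; rewrite !hornerE subr_eq0 => /eqP; exists d.
Qed.

Let pnat_pchar (R : comNzRingType) : p \in [pchar R] -> [pchar R].-nat p.
Proof.
by move=> pR; rewrite pnatE ?(pcharf_prime pR).
Qed.

(** Take p-th roots of the coefficients and use additivity of the p-th power. *)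
Lemma poly_proot (c : {poly k}) : exists d, d ^+ p = c \Po 'X^p.
Proof.
elim/poly_ind: c => [|c a [d dE]].
  by exists 0; rewrite comp_poly0 expr0n -[p == 0]negbK -lt0n prime_gt0 ?(pcharf_prime pchark).
have [s sE] := closed_proot a; exists (d * 'X + s%:P).
rewrite exprDn_pchar; last by apply: pnat_pchar; rewrite pchar_poly.
by rewrite exprMn dE -rmorphXn /= sE comp_polyD comp_polyM comp_polyX comp_polyC.
Qed.

Lemma poly_pdecomp (c : {poly k}) : exists d : nat -> {poly k},
  c = \sum_(i < p) 'X^i * d i ^+ p.
Proof.
have p0 : (0 < p)%N := prime_gt0 (pcharf_prime pchark).
have pP : [pchar {poly k}].-nat p by apply: pnat_pchar; rewrite pchar_poly.
elim/poly_ind: c => [|c a [d dE]].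
  by exists (fun _ => 0); rewrite big1 // => i _; rewrite expr0n eqn0Ngt p0 mulr0.
have [s sE] := closed_proot a.
(* Multiplication by X shifts the components; the last one returns to index 0 with X^p absorbed into
   the p-th power. *)
exists (fun i => if i is i'.+1 then d i' else 'X * d p.-1 + s%:P).
rewrite dE; case: p p0 pP sE {dE} => // q _ qP sE.
rewrite [RHS]big_ord_recl big_ord_recr /= expr0 mul1r exprDn_pchar // exprMn.
rewrite -rmorphXn /= sE mulrDl mulr_suml [RHS]addrC addrA; congr (_ + _ + _).
- by apply: eq_bigr => i _; rewrite /bump leq0n add1n (exprS 'X); ring.
- by rewrite (exprS 'X); ring.
Qed.

End Perfect.

Lemma poly_split (R : comNzRingType) p (P : {poly R}) : (0 < p)%N ->
  P = \sum_(i < p) 'X^i * ((\poly_(a < size P) P`_(p * a + i)) \Po 'X^p).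
Proof.
move=> p0; apply/polyP => j; rewrite coef_sum.
have jp : (j %% p < p)%N by rewrite ltn_mod.
rewrite (bigD1 (Ordinal jp)) //= big1 ?addr0 => [|i ij].
  rewrite coefXnM ltnNge leq_mod /= coef_comp_poly_Xn // coef_poly.
  have -> : (j - j %% p = j %/ p * p)%N by rewrite {1}(divn_eq j p) addnK.
  rewrite dvdn_mull // mulnK // [(p * _)%N]mulnC -divn_eq; case: ltnP => // jP.
  by rewrite nth_default // (leq_trans jP) // leq_div.
rewrite coefXnM; case: ltnP => // ji; rewrite coef_comp_poly_Xn //.
case: ifP => // /dvdnP[q jE]; case/eqP: ij; apply: val_inj => /=.
by rewrite -(subnK ji) jE modnMDl modn_small.
Qed.

Lemma size_poly_split (R : comNzRingType) p (P : {poly R}) (i : nat) : (1 < p)%N ->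
  (1 < size P)%N -> (size (\poly_(a < size P) P`_(p * a + i) : {poly R})%R < size P)%N.
Proof.
move=> p1 P1; rewrite -[ltnRHS]prednK ?(ltnW P1) // ltnS; apply/leq_sizeP => j.
rewrite -ltnS prednK ?(ltnW P1) // => jP; rewrite coef_poly; case: ifP => // _.
rewrite nth_default // (leq_trans jP) // (leq_trans _ (leq_addr _ _)) //.
have j0 : (0 < j)%N by rewrite -ltnS (leq_trans P1).
by rewrite (leq_trans _ (leq_mul p1 (leqnn j))) // mul2n -addnn -addn1 leq_add2l.
Qed.

(** * Polynomial relations over k[w] and relations of least degree *)

Section Bieval.
Variables (k L : fieldType) (g : {rmorphism k -> L}).

Definition bieval (w : L) (P : {poly {poly k}}) (c : L) := (map_poly (evu g w) P).[c].

(** Separability over k(w): if c is a simple root of some polynomial, it is also a simple root of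
    its minimal polynomial. *)
Definition sepover (w c : L) := exists Q : {poly {poly k}},
  bieval w Q c = 0 /\ (map_poly (evu g w) Q)^`().[c] != 0.

Lemma bievalE w (P : {poly {poly k}}) c n : (size P <= n)%N ->
  bieval w P c = \sum_(i < n) evu g w P`_i * c ^+ i.
Proof.
move=> Pn; rewrite /bieval (@horner_coef_wide _ n); last first.
  exact: leq_trans (size_poly _ _) Pn.
by apply: eq_bigr => i _; rewrite coef_map.
Qed.

Lemma evu_compXn w n q : evu g w (q \Po 'X^n) = evu g (w ^+ n) q.
Proof. by rewrite !evuE map_comp_poly map_polyXn horner_comp hornerXn. Qed.

Lemma bieval_compXn w (P : {poly {poly k}}) c n : bieval w (P \Po 'X^n) c = bieval w P (c ^+ n).
Proof. by rewrite /bieval map_comp_poly map_polyXn horner_comp hornerXn. Qed.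

Section Minimal.
Variables (w : L) (w_tr : forall q, evu g w q = 0 -> q = 0).

Lemma bieval_size (P : {poly {poly k}}) c : P != 0 -> bieval w P c = 0 -> (1 < size P)%N.
Proof.
move=> P0 Pc; rewrite ltnNge; apply/negP => /size1_polyC PE; case/eqP: P0.
move: Pc; rewrite PE /bieval map_polyC hornerC => /w_tr ->.
by rewrite polyC0.
Qed.

(** For a relation of least degree, the derivative has smaller degree, so it vanishes at c only if
    it is zero. *)
Lemma bieval_min (P : {poly {poly k}}) c : P != 0 -> bieval w P c = 0 -> sepover w c \/
  exists P0 : {poly {poly k}}, [/\ P0 != 0, bieval w P0 c = 0, P0^`() = 0, (size P0 <= size P)%N &
    forall Q : {poly {poly k}}, (size Q < size P0)%N -> bieval w Q c = 0 -> Q = 0].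
Proof.
move=> P0 Pc; have : exists n, `[< exists Q : {poly {poly k}}, [/\ Q != 0, bieval w Q c = 0 & size Q = n] >].
  by exists (size P); apply/asboolP; exists P.
case/ex_minnP => n /asboolP[Q [Q0 Qc Qn]] nmin.
have min (R : {poly {poly k}}) : (size R < size Q)%N -> bieval w R c = 0 -> R = 0.
  rewrite ltnNge => RQ Rc; apply/eqP; apply: contraNT RQ => R0.
  by rewrite Qn; apply: nmin; apply/asboolP; exists R.
have [Q1|Q1] := eqVneq Q^`() 0.
  right; exists Q; split=> //; rewrite Qn; apply: nmin.
  by apply/asboolP; exists P.
left; exists Q; split=> //; rewrite deriv_map; apply: contra_neq Q1.
by apply: min; apply: lt_size_deriv.
Qed.

End Minimal.
End Bieval.

Lemma deriv_eq0_coef (R : nzRingType) (P : {poly R}) j :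
  P^`() = 0 -> P`_j.+1 *+ j.+1 = 0.
Proof. by move=> P1; rewrite -coef_deriv P1 coef0. Qed.

(** * Separability and p-th powers in characteristic p *)

Section Pchar.
Variables (k : closedFieldType) (L : fieldType) (g : {rmorphism k -> L}).
Variables (p : nat) (pchark : p \in [pchar k]).

Let p_pr : prime p := pcharf_prime pchark.
Let p1 : (1 < p)%N := prime_gt1 p_pr.
Let p0 : (0 < p)%N := prime_gt0 p_pr.
Let pcharL : p \in [pchar L]. Proof. by rewrite (fmorph_pchar g). Qed.
Let fr : {rmorphism L -> L} := GRing.RMorphism.clone _ _ (pFrobenius_aut pcharL) _.
Let frE x : fr x = x ^+ p. Proof. exact: pFrobenius_autE. Qed.

Lemma pexp_inj m : injective (fun x : L => x ^+ (p ^ m)).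
Proof.
elim: m => [|m ih] x y /=; first by rewrite expn0 !expr1.
by rewrite expnS !exprM -!frE => e; apply/(fmorph_inj fr)/ih.
Qed.

Lemma deriv_eq0_compXp (P : {poly {poly k}}) : P^`() = 0 ->
  exists Q, P = Q \Po 'X^p.
Proof.
move=> P1; exists (\poly_(a < size P) P`_(p * a)).
rewrite {1}(poly_split P p0) (bigD1 (Ordinal p0)) //= big1 ?addr0.
  by rewrite expr0 mul1r; congr (_ \Po _); apply: eq_poly => a _; rewrite addn0.
move=> i i0; rewrite [X in X \Po _](_ : _ = 0) ?comp_poly0 ?mulr0 //.
apply/polyP => a; rewrite coef_poly coef0; case: ifP => // _.
have ip : (p * a + i)%N != 0%N by rewrite addn_eq0 negb_and i0 orbT.
have := deriv_eq0_coef (p * a + i).-1 P1; rewrite prednK ?lt0n //.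
rewrite -mulr_natr => /eqP; rewrite mulf_eq0 => /orP[/eqP //|].
have pX : p \in [pchar {poly k}] by rewrite pchar_poly.
rewrite -(dvdn_pcharf pX) dvdn_addr ?dvdn_mulr // => /dvdn_leq.
by rewrite lt0n i0 => /(_ isT); rewrite leqNgt ltn_ord.
Qed.

Lemma size_compXp (Q : {poly {poly k}}) : (1 < size (Q \Po 'X^p))%N ->
  (size Q < size (Q \Po 'X^p))%N.
Proof.
move=> s1; have := size_comp_poly Q 'X^p; rewrite size_polyXn /= => E.
have s0 : (0 < size (Q \Po 'X^p))%N by apply: ltnW.
rewrite -(prednK s0) E in s1 *; move: s1; rewrite !ltnS.
case: (size Q) => [|[|n]] //= _.
by rewrite -[ltnLHS]muln1 ltn_mul2l.
Qed.

(** A least relation with zero derivative is a polynomial in X^p and gives a shorter relation for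
    c^p; iterate. *)
Lemma sepover_pexp w (w_tr : forall q, evu g w q = 0 -> q = 0)
    (P : {poly {poly k}}) c : P != 0 ->
  bieval g w P c = 0 -> exists m, sepover g w (c ^+ (p ^ m)).
Proof.
have [n] := ubnP (size P); elim: n P c => // n ih P c Pn P0 Pc.
have [sc|[Q [Q0 Qc /deriv_eq0_compXp[R QE] QP _]]] := bieval_min P0 Pc.
  by exists 0%N; rewrite expn0 expr1.
have Q1 := bieval_size w_tr Q0 Qc; rewrite QE in Q0 Qc Q1 QP.
have [| | |m sm] := ih R (c ^+ p).
- by rewrite (leq_trans (size_compXp Q1)) // (leq_trans QP).
- by apply: contra_neq Q0 => ->; rewrite comp_poly0.
- by rewrite -bieval_compXn.
by exists m.+1; rewrite expnS exprM.
Qed.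

(** Over the algebraically closed k, q splits into linear factors, one of which must vanish at w. *)
Lemma algebraic_closed_image w q : evu g w q = 0 -> q = 0 \/ exists z, w = g z.
Proof.
have [r qE] := closed_field_poly_normal q.
rewrite evuE qE map_polyZ hornerZ => /eqP; rewrite mulf_eq0 fmorph_eq0 lead_coef_eq0.
case/orP=> [/eqP q0|]; first by left; rewrite q0 lead_coef0 scale0r.
rewrite rmorph_prod horner_prod prodf_seq_eq0 => /hasP[z _ /=].
rewrite rmorphB /= map_polyX map_polyC hornerXsubC subr_eq0 => /eqP wz.
by right; exists z.
Qed.

Lemma nonpower_transcendental w : (forall y, y ^+ p != w) ->
  forall q, evu g w q = 0 -> q = 0.
Proof.
move=> nw q /algebraic_closed_image[//|[z wz]]; have [d dz] := closed_proot pchark z.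
by have := nw (g d); rewrite -rmorphXn dz wz eqxx.
Qed.

(** If the least relation is R(X^p), splitting its coefficients over the p-th powers in k[X] turns
    it into a sum of w^i h_i(c)^p. As w is not a p-th power, all h_i(c) vanish, and these relations
    are shorter. *)
Lemma sepover_nonpower w (P : {poly {poly k}}) c : (forall y, y ^+ p != w) -> P != 0 ->
  bieval g w P c = 0 -> sepover g w c.
Proof.
move=> nw P0 Pc; have w_tr := nonpower_transcendental nw.
have [//|[Q [Q0 Qc /deriv_eq0_compXp[R QE] _ Qmin]]] := bieval_min P0 Pc.
exfalso; have Q1 := bieval_size w_tr Q0 Qc.
have RQ : (size R < size Q)%N by rewrite QE size_compXp // -QE.
have [d dE] := choice (fun m => poly_pdecomp pchark R`_m).
pose h i : {poly {poly k}} := \poly_(m < size R) d m i.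
have hs i : (size (h i) <= size R)%N by apply: size_poly.
have R0 i : (i < p)%N -> bieval g w (h i) c = 0.
  apply: (pow_free pcharL (z := fun i => bieval g w (h i) c) nw).
  rewrite -[RHS]Qc QE bieval_compXn (bievalE _ _ _ (leqnn _)).
  rewrite (eq_bigr (fun i : 'I_p => \sum_(m < size R)
      w ^+ i * (evu g w (d m i) ^+ p * (c ^+ p) ^+ m))) => [|i' _].
    rewrite exchange_big; apply: eq_bigr => m _.
    rewrite dE rmorph_sum mulr_suml; apply: eq_bigr => i' _.
    by rewrite rmorphM !(rmorphXn (evu g w)) evuX mulrA.
  rewrite (bievalE _ _ _ (hs i')) -frE rmorph_sum mulr_sumr; apply: eq_bigr => m _.
  by rewrite rmorphM !frE coef_poly ltn_ord -!exprM mulnC.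
case/eqP: Q0; rewrite QE [R](_ : _ = 0) ?comp_poly0 //; apply/polyP => m.
rewrite coef0; have [mR|/(nth_default 0)//] := ltnP m (size R).
rewrite dE big1 // => i' _.
have := Qmin (h i') (leq_ltn_trans (hs i') RQ) (R0 i' (ltn_ord i')).
move/(congr1 (fun q : {poly {poly k}} => q`_m)); rewrite coef_poly mR coef0 => ->.
by rewrite expr0n eqn0Ngt p0 mulr0.
Qed.

Lemma bieval_proot (H : {poly {poly k}}) : exists H' : {poly {poly k}},
  [/\ (size H' <= size H)%N, H' = 0 -> H = 0 &
    forall v c, bieval g (v ^+ p) H (c ^+ p) = bieval g v H' c ^+ p].
Proof.
have [d dE] := choice (fun m => poly_proot pchark H`_m).
pose H' : {poly {poly k}} := \poly_(m < size H) d m.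
exists H'; split=> [|H0|v c]; first exact: size_poly.
  apply/polyP => m; rewrite coef0; have [mH|/(nth_default 0)//] := ltnP m (size H).
  have := congr1 (fun q : {poly {poly k}} => q`_m) H0; rewrite coef_poly mH coef0 => dm.
  apply/eqP; rewrite -(@comp_poly_eq0 _ _ 'X^p) ?size_polyXn // -dE dm expr0n.
  by rewrite eqn0Ngt p0.
rewrite (bievalE _ _ _ (leqnn _)) (bievalE _ _ _ (size_poly _ _)) -[RHS]frE rmorph_sum.
apply: eq_bigr => m _; rewrite -evu_compXn -dE coef_poly ltn_ord rmorphM !frE.
by rewrite rmorphXn /= -!exprM mulnC.
Qed.

(* If c is not a p-th power, the relation of least degree for c over the fields
   k(w^(1/p^m)) splits, after a p-th root of its coefficients, into smaller ones. *)
Lemma perfect_of_proots (w : L) (w_tr : forall q, evu g w q = 0 -> q = 0) :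
    (forall m, exists v : L, v ^+ (p ^ m) = w) ->
    (forall c, exists2 P : {poly {poly k}}, P != 0 & bieval g w P c = 0) ->
  forall c, exists y : L, y ^+ p = c.
Proof.
move=> wroot walg c; apply: contrapT => nc.
have {}nc y : y ^+ p != c by apply/eqP => yc; apply: nc; exists y.
(* The least degree is taken over all p-power roots v of w at once, since the argument passes from v
   to a p-th root of v. *)
have : exists n, `[< exists (v : L) m (P : {poly {poly k}}), [/\ v ^+ (p ^ m) = w, P != 0, bieval g v P c = 0
    & size P = n] >].
  have [P P0 Pc] := walg c; exists (size P); apply/asboolP.
  by exists w, 0%N, P; rewrite expn0 expr1.
case/ex_minnP => n /asboolP[v [m [P [vm P0 Pc Pn]]]] nmin.
have v_tr q : evu g v q = 0 -> q = 0.
  move=> /algebraic_closed_image[//|[z vz]].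
  have /eqP : 'X - (z ^+ (p ^ m))%:P = 0 :> {poly k}; last by rewrite polyXsubC_eq0.
  by apply: w_tr; rewrite (rmorphB (evu g w)) evuX evuC -vm vz rmorphXn subrr.
have P1 := bieval_size v_tr P0 Pc.
have [v' v'm] := wroot m.+1; have v'E : v' ^+ p = v.
  by apply: (@pexp_inj m); rewrite -exprM -expnS v'm.
pose h i : {poly {poly k}} := \poly_(a < size P) P`_(p * a + i).
have [h' h'E] := choice (fun i => bieval_proot (h i)).
(* Splitting P by exponents modulo p writes the relation as a sum of c^i h'_i(v', c)^p, to which
   [pow_free] applies because c is not a p-th power. *)
have z0 i : (i < p)%N -> bieval g v' (h' i) c = 0.
  apply: (pow_free pcharL (z := fun i => bieval g v' (h' i) c) nc).
  rewrite -[RHS]Pc [in RHS](poly_split P p0) /bieval rmorph_sum horner_sum.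
  apply: eq_bigr => i' _; have [_ _ E] := h'E i'.
  rewrite -[_.[c] ^+ p]E v'E rmorphM /= hornerM map_polyXn hornerXn.
  by rewrite -bieval_compXn.
case/eqP: P0; rewrite (poly_split P p0) big1 // => i _.
have [sh h0 _] := h'E i; rewrite -/(h i) h0 ?comp_poly0 ?mulr0 //.
apply/eqP; apply: contraT => h'0; have := nmin (size (h' i)).
have sP : (size (h' i) < size P)%N := leq_ltn_trans sh (size_poly_split i p1 P1).
rewrite -Pn leqNgt sP => /(_ _)/negP; case; last by [].
by apply/asboolP; exists v', m.+1, (h' i); rewrite z0.
Qed.

End Pchar.

Lemma subfieldGen_full (L : fieldType) (X S : set L) :
  subfieldGen X = setT -> divring_closed (mem S) -> (X `<=` S)%classic -> S = setT.
Proof.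
move=> genX Sc XS; apply/seteqP; split=> // x _.
have xX : subfieldGen X x by rewrite genX.
exact: (xX S (conj Sc XS)).
Qed.

Lemma countable_sequence (L : fieldType) (A : set L) : countable A ->
  exists b : nat -> L, (forall n, b n != 0) /\
    forall x, A x -> x != 0 -> exists n, b n = x.
Proof.
move=> /countable_injP[code code_inj].
pose X n := [set x | [/\ A x, code x = n & x != 0]]%classic.
exists (fun n => xget 1 (X n)); split=> [n|x Ax x0].
  by case: xgetP => [x _ []|_] //; rewrite oner_eq0.
exists (code x); case: xgetP => [y _ [Ay yx _]|/(_ x)[]//].
by apply: code_inj; rewrite ?inE.
Qed.

(** * Clearing denominators in k(u) *)

Section GeneratedByOne.
Variables (k E : fieldType) (i : {rmorphism k -> E}) (u : E).
Hypothesis E_gen : subfieldGen (range i `|` [set u])%classic = setT.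

(** The fractions in u form a subfield containing k and u. *)
Lemma generated_fraction e : exists N D : {poly k},
  evu i u D != 0 /\ e * evu i u D = evu i u N.
Proof.
pose S : set E := [set e | exists N D : {poly k},
  evu i u D != 0 /\ e * evu i u D = evu i u N]%classic.
suff ST : S = setT by have : S e by rewrite ST.
apply: (subfieldGen_full E_gen) => [|x [[c _ <-]|->]].
- split=> [|x y|x y]; rewrite !inE.
  + by exists 1, 1; rewrite !rmorph1 mulr1 oner_eq0.
  + move=> [N [D [D0 xE]]] [N' [D' [D0' yE]]]; exists (N * D' - N' * D), (D * D').
    by rewrite rmorphB !rmorphM mulf_neq0 // -xE -yE; split=> //; ring.
  move=> [N [D [D0 xE]]] [N' [D' [D0' yE]]].
  have [->|y0] := eqVneq y 0.
    by exists 0, 1; rewrite invr0 mulr0 mul0r rmorph0 rmorph1 oner_eq0.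
  exists (N * D'), (D * N'); rewrite !rmorphM -xE -yE !mulf_neq0 //; split=> //.
  by rewrite -[RHS]mulr1 -(mulVf y0); ring.
- by exists c%:P, 1; rewrite evuC rmorph1 mulr1 oner_eq0.
by exists 'X, 1; rewrite evuX rmorph1 mulr1 oner_eq0.
Qed.

Lemma clear_denominators (P : {poly E}) : exists (Q : {poly {poly k}}) (D : {poly k}),
  evu i u D != 0 /\ map_poly (evu i u) Q = evu i u D *: P.
Proof.
elim/poly_ind: P => [|P c [Q [D [D0 QE]]]].
  by exists 0, 1; rewrite rmorph0 rmorph1 oner_eq0 scaler0.
have [N [D' [D0' cE]]] := generated_fraction c.
exists (D' *: Q * 'X + (D * N)%:P), (D * D'); rewrite rmorphM mulf_neq0 //; split=> //.
rewrite rmorphD rmorphM /= map_polyZ map_polyX map_polyC QE.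
rewrite -[X in _ + X%:P]/(evu i u (D * N)) rmorphM -cE.
by rewrite -!mul_polyC !polyCM; ring.
Qed.

Variables (L : fieldType) (f : {rmorphism E -> L}).
Local Notation g := (GRing.RMorphism.clone k L (f \o i) _).

Lemma evu_comp c : f (evu i u c) = evu g (f u) c.
Proof. by rewrite !evuE map_poly_comp horner_map. Qed.

Lemma algebraic_bieval b : algebraicOver f b ->
  exists2 P : {poly {poly k}}, P != 0 & bieval g (f u) P b = 0.
Proof.
move=> [P P0 /rootP Pb]; have [Q [D [D0 QE]]] := clear_denominators P.
exists Q.
  apply: contra_neq P0 => Q0; move: QE; rewrite Q0 rmorph0 => /esym/eqP.
  by rewrite scaler_eq0 (negPf D0) => /eqP.
rewrite /bieval; have -> : map_poly (evu g (f u)) Q = map_poly f (map_poly (evu i u) Q).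
  rewrite -map_poly_comp; apply: eq_map_poly => c /=; exact/esym/evu_comp.
by rewrite QE map_polyZ hornerZ Pb mulr0.
Qed.

End GeneratedByOne.

(** * Choice of the transcendental element and of the roots of the generators *)

Theorem mainTheorem3 (k : closedFieldType)
  (E : fieldType) (i : {rmorphism k -> E}) (u : E)
  (u_transcendental : ~ algebraicOver i u)
  (E_generated : (subfieldGen (range i `|` [set u]) = setT)%classic)
  (L : fieldType) (f : {rmorphism E -> L})
  (L_algebraic : algebraicExt f)
  (L_countably_generated : countablyGenerated f) :
  exists v : discreteValuation (mfracC 3 k),
    [/\ forall g : {mfps k[3]}, tofrac g \in vring_pred v,
        center v =i mfps_maxideal
      & exists2 phi : {rmorphism residueField v -> L},
          bijective phi & forall c : k, phi (residueC v c) = f (i c)].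
Proof.
have [A /countable_sequence[b [b0 bA]] Lgen] := L_countably_generated.
pose g : {rmorphism k -> L} := GRing.RMorphism.clone k L (f \o i) _.
have u_tr q : evu g (f u) q = 0 -> q = 0.
  move=> /eqP; rewrite -evu_comp fmorph_eq0 => qu; apply/eqP.
  by apply: contraT => q0; case: u_transcendental; exists q.
have alg c := algebraic_bieval E_generated (L_algebraic c).
have gen (S : set L) : divring_closed (mem S) -> (forall c, S (g c)) -> S (f u) ->
    (forall n, S (b n)) -> S = setT.
  move=> Sc Sg Su Sb; have [S1 SB SV] := Sc.
  apply: (subfieldGen_full Lgen Sc) => x [[e _ <-]|Ax]; last first.
    have [->|/(bA _ Ax)[n <-]//] := eqVneq x 0.
    by have := SB _ _ S1 S1; rewrite subrr inE.
  suff T : [set e | S (f e)]%classic = setT.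
    by have : [set e | S (f e)]%classic e by rewrite T.
  apply: (subfieldGen_full E_generated) => [|y [[c _ <-]|->] //]; last exact: Sg.
  split=> [|x' y'|x' y']; rewrite !inE /= ?rmorph1 ?rmorphB ?fmorph_div.
  - by rewrite inE in S1.
  - by move=> Sx Sy; have := SB (f x') (f y'); rewrite !inE; apply.
  by move=> Sx Sy; have := SV (f x') (f y'); rewrite !inE; apply.
(* When L is separable over k(w), all r_n can be 1 and the generators are their own roots; u must
   then be recovered from w. *)
have unit_r (w : L) : (forall q, evu g w q = 0 -> q = 0) ->
    (forall c, sepover g w c) -> (forall S : set L, divring_closed (mem S) -> S w -> S (f u)) ->
  exists v : discreteValuation (mfracC 3 k),
    [/\ forall g : {mfps k[3]}, tofrac g \in vring_pred v,
        center v =i mfps_maxideal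
      & exists2 phi : {rmorphism residueField v -> L},
          bijective phi & forall c : k, phi (residueC v c) = f (i c)].
  move=> w_tr w_sep Sw; apply: (@realization k L g w w_tr b b (fun=> 1%N)) => //.
  - by move=> n; rewrite big1 ?expr1.
  - by move=> n; apply: w_sep.
  by move=> S Sc Sg Sw' Sb; apply: gen => //; apply: Sw.
(* In characteristic 0 a nonconstant polynomial has nonzero derivative, so w = u works. *)
have [[p pk]|k0] := pselect (exists p, p \in [pchar k]); last first.
  apply: (unit_r (f u)) => // c; have [P P0 Pc] := alg c.
  have [//|[Q [Q0 Qc Q1 _ _]]] := bieval_min P0 Pc.
  have := bieval_size u_tr Q0 Qc; case sQ: (size Q) => [|[|n]] // _.
  have := deriv_eq0_coef n Q1; rewrite -mulr_natr => /eqP; rewrite mulf_eq0.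
  have /pcharf0P k0' : [pchar {poly k}] =i pred0.
    by move=> p; rewrite pchar_poly; apply/negP => pk; apply: k0; exists p.
  rewrite k0' orbF => Qn.
  by have := lead_coef_eq0 Q; rewrite lead_coefE sQ /= Qn (negPf Q0).
(* If u has p^m-th roots in L for every m, then L is perfect; otherwise some root of u is not a p-th
   power. *)
have [roots|noroots] := pselect (forall m, exists v : L, v ^+ (p ^ m) = f u).
  have perf := perfect_of_proots pk u_tr roots alg.
  have sep n : exists m, sepover g (f u) (b n ^+ (p ^ m)).
    by have [P P0 Pc] := alg (b n); exact: (sepover_pexp pk u_tr P0 Pc).
  have [m sepm] := choice sep.
  have root s c : exists y : L, y ^+ (p ^ s) = c.
    elim: s c => [|s ih] c; first by exists c; rewrite expn0 expr1.
    have [y yc] := perf c; have [z zy] := ih y.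
    by exists z; rewrite expnSr exprM zy.
  (* With r_n = p^(m_n), the product of the earlier r_j is p to the sum of the m_j. *)
  have [beta betaE] := choice (fun n => root (\sum_(j < n) m j)%N (b n)).
  apply: (@realization k L g (f u) u_tr b beta (fun n => p ^ m n)%N) => //.
    move=> n; by rewrite pnatX pnatE ?(pcharf_prime pk) // (fmorph_pchar g) pk.
  by move=> n; rewrite -betaE expn_sum.
have : exists m, `[< ~ exists v : L, v ^+ (p ^ m) = f u >].
  apply: contrapT => h; apply: noroots => m; apply: contrapT => hm.
  by apply: h; exists m; apply/asboolP.
case/ex_minnP => -[|m] /asboolP hm mmin.
  by case: hm; exists (f u); rewrite expn0 expr1.
(* By minimality u is a p^m-th power but not a p^(m+1)-th power, so w is not a p-th power. *)
have [w wm] : exists v : L, v ^+ (p ^ m) = f u.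
  apply: contrapT => h; have := mmin m; rewrite ltnn => /(_ _)/negP; case=> //.
  exact/asboolP.
have nw y : y ^+ p != w.
  by apply/eqP => yw; apply: hm; exists y; rewrite expnS exprM yw.
apply: (unit_r w) => [|c|S Sc Sw].
- exact: (@nonpower_transcendental _ _ g p pk w nw).
- have [P P0 Pc] := alg c.
  (* Since u = w^(p^m), a relation over k[u] becomes one over k[w] on replacing X by X^(p^m) in the
     coefficients. *)
  apply: (sepover_nonpower pk nw (P := map_poly (comp_poly 'X^(p ^ m)) P)).
    apply: contra_neq P0 => P0; apply/polyP => j; rewrite coef0.
    have := congr1 (fun q : {poly {poly k}} => q`_j) P0; rewrite coef_map coef0 => /eqP.
    rewrite comp_poly_eq0 ?size_polyXn ?ltnS ?expn_gt0 ?prime_gt0 ?(pcharf_prime pk) //.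
    by move/eqP.
  rewrite -Pc -wm /bieval -map_poly_comp; congr (_.[c]).
  by apply: eq_map_poly => q; apply: evu_compXn.
have [S1 _ SV] := Sc; rewrite -wm.
elim: (p ^ m)%N => [|n ih]; first by move: S1; rewrite inE expr0.
(* Closure is given for division, so the product w w^n is formed as w / (1 / w^n). *)
have S1n : S (1 / w ^+ n) by have := SV 1 (w ^+ n); rewrite !inE => /(_ _ ih); apply; rewrite inE in S1.
have := SV w (1 / w ^+ n); rewrite !inE => /(_ Sw S1n).
by rewrite div1r invrK -exprS.
Qed.
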